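(* Let $K$ be an infinite field and let $n>d>0$ be integers. Let $U\subset R_{[n-d-1]}$ be a shifted order ideal of monomials of degree at most $\lfloor \frac{d+1}{2}\rfloor$, let $B_d(U)$ be the corresponding squeezed $d$-ball on $[n]$, and let $I(U)\subset R_{[n]}$ be the ideal generated by all monomials $u\in R_{[n-d-1]}$ with $u\notin U$. Then $$I_{B_d(U)}=\alpha^2(I(U)).$$ In particular, $\mathrm{gin}(I_{B_d(U)})=I(U)$.
   Context: $K$ is an infinite field, $R_{[n]}=K[x_1,\dots,x_n]$ with each $\deg x_i=1$ ($R_{[0]}=K$), and $[n]=\{1,\dots,n\}$. For a graded ideal $I\subset R_{[n]}$, $\mathrm{gin}(I)$ is the generic initial ideal of $I$ with respect to the degree reverse lexicographic order induced by $x_1>\cdots>x_n$. The Stanley--Reisner ideal $I_\Gamma\subset R_{[n]}$ of a simplicial complex $\Gamma$ on $[n]$ is generated by all squarefree monomials $x_{i_1}\cdots x_{i_k}$ with $\{i_1,\dots,i_k\}\notin\Gamma$. For monomials $u=x_{i_1}\cdots x_{i_k}$, $v=x_{j_1}\cdots x_{j_k}$ of the same degree with $i_1\le\cdots\le i_k$, $j_1\le\cdots\le j_k$, write $u\preceq v$ if $i_p\le j_p$ for all $p$. A set $U$ of monomials of $R_{[m]}$ is a shifted order ideal of monomials if (i) $\{1,x_1,\dots,x_m\}\subset U$; (ii) $u\in U$ and $v$ divides $u$ imply $v\in U$; (iii) $u\in U$, $v \in R_{[m]}$ a monomial and $u\preceq v$ imply $v\in U$. It is ''of degree at most $k$'' if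 all its elements have degree at most $k$. Squeezed balls: with $m=n-d-1$ and $U\subset R_{[m]}$ a shifted order ideal of monomials of degree at most $\lfloor\frac{d+1}{2}\rfloor$, for $u=x_{i_1}\cdots x_{i_k}\in U$ with $i_1\le\cdots\le i_k$ put $$F_d(u)=\{i_1,i_1+1\}\cup\{i_2+2,i_2+3\}\cup\cdots\cup\{i_k+2(k-1),i_k+2k-1\}\cup\{n+2k-d,n+2k-d+1,\dots,n\},$$ a $(d+1)$-subset of $[n]$ (with $F_d(1)=\{n-d,\dots,n\}$). $B_d(U)$ is the simplicial complex on $[n]$ generated by $\{F_d(u):u\in U\}$. The map $\alpha^2$ on monomials is $\alpha^2(x_{i_1}x_{i_2}\cdots x_{i_k})=x_{i_1}x_{i_2+2}x_{i_3+4}\cdots x_{i_k+2(k-1)}$ for $i_1\le\cdots\le i_k$. $\alpha^2(I(U))$ is the ideal of $R_{[n]}$ generated by $\{\alpha^2(u):u\in G(I(U))\}$, where $G(I)$ is the set of minimal monomial generators of $I$ (these $\alpha^2(u)$ all lie in $R_{[n]}$). *)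

(* Defs.v *)
From HB Require Import structures.
From mathcomp Require Import all_boot all_order all_algebra.
From mathcomp Require Import mpoly.

Set Implicit Arguments.
Unset Strict Implicit.
Unset Printing Implicit Defensive.

Import Order.TTheory GRing.Theory.

Local Open Scope ring_scope.

Definition infinite_field (K : fieldType) : Prop :=
  forall s : seq K, exists x : K, x \notin s.

(* The ordinal i : 'I_n stands for the variable x_(i+1), and for the vertex   *)
(* i+1 of [n].                                                                *)

(* Index sequences of monomials: the unique i_1 <= ... <= i_k, with values    *)
(* in {1, ..., n}, such that u = x_(i_1) ... x_(i_k).                         *)
Definition indices (n : nat) (u : 'X_{1..n}) : seq nat :=
  flatten [seq nseq (u i) (i : nat).+1 | i <- enum 'I_n].

Section Ideals.
Context (K : fieldType) (n : nat).
Implicit Types (I S : {mpoly K[n]} -> Prop) (f h : {mpoly K[n]}).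

Definition ideal_gen S f : Prop :=
  exists s : seq ({mpoly K[n]} * {mpoly K[n]}),
    (forall p, p \in s -> S p.2) /\ f = \sum_(p <- s) p.1 * p.2.

(* The minimal monomial generators G(I) of a monomial ideal I. *)
Definition min_gens I (u : 'X_{1..n}) : Prop :=
  I 'X_[u] /\ forall v : 'X_{1..n}, I 'X_[v] -> (v <= u)%MM -> v = u.

(* Degree reverse lexicographic order with x_1 > ... > x_n.  The order        *)
(* (_ < _)%O that mpoly.v puts on monomials cannot be used: despite its       *)
(* documentation, it is the degree lexicographic order.                       *)
Definition degrevlex_lt (u v : 'X_{1..n}) : bool :=
  (mdeg u < mdeg v)%N ||
  (mdeg u == mdeg v) &&
    [exists i : 'I_n, (v i < u i)%N &&
       [forall j : 'I_n, (i < j)%N ==> (u j == v j)]].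

Definition is_lead_mon f (u : 'X_{1..n}) : Prop :=
  u \in msupp f /\
  forall v, v \in msupp f -> v != u -> degrevlex_lt v u.

Definition initial_ideal I : {mpoly K[n]} -> Prop :=
  ideal_gen (fun p => exists f u, [/\ I f, is_lead_mon f u & p = 'X_[u]]).

(* The graded automorphism x_i |-> \sum_j g_ij x_j of K[x_1, ..., x_n]. *)
Definition lin_subst (g : 'M[K]_n) f : {mpoly K[n]} :=
  f \mPo [tuple \sum_(j < n) g i j *: 'X_j | i < n].

Definition lin_image (g : 'M[K]_n) I f : Prop :=
  exists h, I h /\ f = lin_subst g h.

(* Zariski open subsets of GL_n(K); the variables of {mpoly K[n * n]} are the *)
(* matrix entries, in the order fixed by mxvec.                               *)
Definition zariski_open_GL (V : 'M[K]_n -> Prop) : Prop :=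
  exists S : {mpoly K[n * n]} -> Prop, forall g : 'M[K]_n,
    V g <-> g \in unitmx /\
            exists P, S P /\ P.@[fun k => mxvec g ord0 k] != 0.

(* gin(I) = J: the initial ideal of g I is J for all g in some nonempty       *)
(* Zariski open subset of GL_n(K).                                            *)
Definition is_gin I J : Prop :=
  exists V : 'M[K]_n -> Prop,
    [/\ zariski_open_GL V, exists g, V g &
        forall g, V g ->
          forall f, initial_ideal (lin_image g I) f <-> J f].

Definition stanley_reisner_ideal (Gamma : {set 'I_n} -> Prop) :
    {mpoly K[n]} -> Prop :=
  ideal_gen (fun p => exists A : {set 'I_n},
    ~ Gamma A /\ p = \prod_(i in A) 'X_i).

End Ideals.

Definition mon_shift_le (n : nat) (u v : 'X_{1..n}) : bool :=
  all2 leq (indices u) (indices v).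

Record shifted_order_ideal (m : nat) (U : 'X_{1..m} -> Prop) : Prop :=
  ShiftedOrderIdeal {
    soi_one : U 0%MM;
    soi_var : forall i : 'I_m, U U_(i)%MM;
    soi_div : forall u v : 'X_{1..m}, U u -> (v <= u)%MM -> U v;
    soi_shift : forall u v : 'X_{1..m}, U u -> mon_shift_le u v -> U v
  }.

Definition degree_at_most (m : nat) (U : 'X_{1..m} -> Prop) (k : nat) : Prop :=
  forall u, U u -> (mdeg u <= k)%N.

(* F_d(u) for u with index sequence s; p ranges over 0, ..., k-1, so that     *)
(* nth 0 s p is i_(p+1).                                                      *)
Definition squeezed_facet (n d : nat) (s : seq nat) : {set 'I_n} :=
  [set x : 'I_n |
     [exists p : 'I_(size s),
        ((x : nat).+1 == nth 0 s p + 2 * p)%N ||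
        ((x : nat).+1 == nth 0 s p + 2 * p + 1)%N]
     || (n + 2 * size s - d <= (x : nat).+1)%N].

Definition squeezed_ball (n d : nat) (U : 'X_{1..n - d - 1} -> Prop)
    (A : {set 'I_n}) : Prop :=
  exists u, U u /\ A \subset squeezed_facet n d (indices u).

(* The monomial u of K[x_1, ..., x_m], seen in K[x_1, ..., x_n], m <= n. *)
Definition mon_embed (m n : nat) (u : 'X_{1..m}) : 'X_{1..n} :=
  [multinom oapp (fun j : 'I_m => u j) 0%N (insub (i : nat)) | i < n].

Definition ideal_outside (K : fieldType) (m n : nat) (U : 'X_{1..m} -> Prop) :
    {mpoly K[n]} -> Prop :=
  ideal_gen (fun p => exists u : 'X_{1..m},
    ~ U u /\ p = 'X_[mon_embed n u]).

(* alpha^2 acts on monomials in infinitely many variables, represented by     *)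
(* their index sequences; is_alpha2 u w says that alpha^2(u) is w, hence in   *)
(* particular that alpha^2(u) only involves x_1, ..., x_n.  Such a w exists   *)
(* for every u in G(I(U)), so alpha2_ideal misses no generator there.         *)
Definition alpha2_indices (s : seq nat) : seq nat :=
  [seq (nth 0 s p + 2 * p)%N | p <- iota 0 (size s)].

Definition is_alpha2 (n : nat) (u w : 'X_{1..n}) : Prop :=
  indices w = alpha2_indices (indices u).

Definition alpha2_ideal (K : fieldType) (n : nat) (I : {mpoly K[n]} -> Prop) :
    {mpoly K[n]} -> Prop :=
  ideal_gen (fun p => exists u w : 'X_{1..n},
    [/\ min_gens I u, is_alpha2 u w & p = 'X_[w]]).

Arguments squeezed_ball : clear implicits.
Arguments ideal_outside K {m} n U f.
Arguments stanley_reisner_ideal K {n} Gamma f.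

(* Main.v *)
Require Import Defs.
From mathcomp Require Import all_boot all_order all_algebra.
From mathcomp Require Import mpoly.
From mathcomp Require Import zify ring.
From Stdlib Require Import Classical.

Set Implicit Arguments.
Unset Strict Implicit.
Unset Printing Implicit Defensive.

(** Write J for the Stanley-Reisner ideal of the ball.  A greedy choice of
    vertices at mutual distance at least two shows that a set is not a face
    exactly when it contains s_1, s_2 + 2, s_3 + 4, ... for the index sequence s
    of a monomial outside U ([not_ball_outside], [outside_not_ball]).  Hence J
    and alpha^2(I(U)) have the same monomials, which gives the first claim.

    For the second claim, let g be a matrix whose minors on any rows and the
    first columns are nonzero, and put l_i = g(x_i).  This condition defines a
    nonempty open set, since Vandermonde matrices with distinct nodes satisfy it
    ([general_position_exists]).  The two inclusions between the initial ideal of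
    g(J) and I(U) are obtained as follows.

    Let Q(p, c) be the ideal generated by the products of p of the forms
    l_1, ..., l_(c+2p-2) whose indices are at mutual distance at least two.  As
    for a Cohen-Macaulay ideal of codimension c, general position makes
    x_n, ..., x_(c+1) a regular sequence modulo Q(p, c) ([gap_ideal_regular]).  In
    the reverse lexicographic order it follows that the leading monomial of a
    homogeneous element of Q(p, c) has degree at least p in x_1, ..., x_c
    ([gap_ideal_lead]).  Now let s be the index sequence of a monomial outside U.
    The elements g(alpha^2(v)), for the monomials v with index sequence at most
    s, lie in Q(p, s_p) for all p, so that the leading monomials of their
    combinations are themselves at most s.  For reasons of dimension all these
    monomials occur as leading monomials, and the initial ideal of g(J) contains
    the monomial of s ([lead_of_image_outside]).

    Conversely, J has at most as many monomials of each degree as I(U): an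
    explicit injection ([fold_mon]) closes the gaps in s_1, s_2 + 2, ... by
    moving each chosen variable, together with its successor, to the end of the
    list of variables.  A leading monomial of g(J) outside I(U) would therefore
    exceed the dimension available ([lead_of_image_inside]). *)

(** * Ideals of linear forms *)

Section LinearForms.
Import Order.TTheory GRing.Theory.
Local Open Scope ring_scope.
Context (K : fieldType) (n : nat).
Implicit Types (f h a : {mpoly K[n]}) (v y : 'rV[K]_n) (Z : seq 'rV[K]_n).

Definition linear_form v : {mpoly K[n]} := \sum_(j < n) v ord0 j *: 'X_j.

Lemma linear_formD v y : linear_form (v + y) = linear_form v + linear_form y.
Proof. by rewrite -big_split; apply: eq_bigr => j _; rewrite mxE scalerDl. Qed.

Lemma linear_formZ (k : K) v : linear_form (k *: v) = k *: linear_form v.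
Proof.
by rewrite scaler_sumr; apply: eq_bigr => j _; rewrite mxE scalerA.
Qed.

Lemma linear_formB v y : linear_form (v - y) = linear_form v - linear_form y.
Proof. by rewrite linear_formD -scaleN1r linear_formZ scaleN1r. Qed.

Lemma linear_form0 : linear_form 0 = 0.
Proof. by rewrite -(scale0r 0) linear_formZ scale0r. Qed.

Lemma mcoeff_linear_form v j : (linear_form v)@_U_(j) = v ord0 j.
Proof.
rewrite raddf_sum /= (bigD1 j) //= mcoeffZ mcoeffX eqxx mulr1.
rewrite big1 ?addr0 // => i ne_ij.
by rewrite mcoeffZ mcoeffX eq_mnm1 (negPf ne_ij) mulr0.
Qed.

Lemma linear_form_eq0 v : (linear_form v == 0) = (v == 0).
Proof.
apply/eqP/eqP=> [v0 | ->]; last exact: linear_form0.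
by apply/rowP=> j; rewrite mxE -mcoeff_linear_form v0 mcoeff0.
Qed.

Lemma msupp_linear_form v w : w \in msupp (linear_form v) -> mdeg w = 1%N.
Proof.
move/msupp_sum_le=> /flattenP[s /mapP[j _ ->]] /msuppZ_le.
by rewrite msuppX inE => /eqP->; rewrite mdeg1.
Qed.

Lemma lin_substXU (g : 'M[K]_n) i : lin_subst g 'X_i = linear_form (row i g).
Proof.
rewrite /lin_subst comp_mpolyXU -tnth_nth tnth_mktuple.
by apply: eq_bigr => j _; rewrite mxE.
Qed.

Lemma lin_substC (g : 'M[K]_n) c : lin_subst g c%:MP = c%:MP.
Proof. exact: comp_mpolyC. Qed.
Lemma lin_substD (g : 'M[K]_n) : {morph lin_subst g : f h / f + h}.
Proof. exact: comp_mpolyD. Qed.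
Lemma lin_substM (g : 'M[K]_n) : {morph lin_subst g : f h / f * h}.
Proof. by move=> f h; rewrite /lin_subst rmorphM. Qed.
Lemma lin_subst0 (g : 'M[K]_n) : lin_subst g 0 = 0.
Proof. exact: comp_mpoly0. Qed.
Lemma lin_subst1 (g : 'M[K]_n) : lin_subst g 1 = 1.
Proof. exact: comp_mpoly1. Qed.
Lemma lin_substZ (g : 'M[K]_n) c f : lin_subst g (c *: f) = c *: lin_subst g f.
Proof. exact: comp_mpolyZ. Qed.
Lemma lin_subst_sum (g : 'M[K]_n) I (r : seq I) (F : I -> {mpoly K[n]}) :
  lin_subst g (\sum_(i <- r) F i) = \sum_(i <- r) lin_subst g (F i).
Proof. by rewrite /lin_subst raddf_sum. Qed.

Lemma lin_subst_linear_form (g : 'M[K]_n) v :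
  lin_subst g (linear_form v) = linear_form (v *m g).
Proof.
rewrite /linear_form lin_subst_sum.
under eq_bigr do rewrite lin_substZ lin_substXU scaler_sumr.
rewrite exchange_big; apply: eq_bigr => j _.
under eq_bigr do rewrite mxE scalerA.
by rewrite -scaler_suml mxE.
Qed.

(** Reduces statements compatible with sums and products to the scalars and the
    variables. *)
Lemma mpoly_alg_ind (P : {mpoly K[n]} -> Prop) :
  (forall c, P c%:MP) -> (forall i, P 'X_i) ->
  (forall f h, P f -> P h -> P (f + h)) ->
  (forall f h, P f -> P h -> P (f * h)) -> forall f, P f.
Proof.
move=> PC PX PD PM f; rewrite (mpolyE f); elim: (msupp f) => [|m s IHs].
  by rewrite big_nil -mpolyC0.
rewrite big_cons; apply: (PD) IHs; rewrite -mul_mpolyC; apply: (PM) => //.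
rewrite mpolyXE_id.
elim/big_ind: _ => [|f1 f2|i _]; [by rewrite -mpolyC1 | exact: PM |].
by elim: (m i) => [|k IHk]; rewrite ?expr0 -?mpolyC1 // exprS; apply: PM.
Qed.

Lemma lin_subst_comp (g1 g2 : 'M[K]_n) f :
  lin_subst g2 (lin_subst g1 f) = lin_subst (g1 *m g2) f.
Proof.
elim/mpoly_alg_ind: f => [c|i|f h IHf IHh|f h IHf IHh].
- by rewrite !lin_substC.
- by rewrite !lin_substXU lin_subst_linear_form row_mul.
- by rewrite !lin_substD IHf IHh.
- by rewrite !lin_substM IHf IHh.
Qed.

Lemma lin_subst_id f : lin_subst 1%:M f = f.
Proof.
elim/mpoly_alg_ind: f => [c|i|f h IHf IHh|f h IHf IHh].
- by rewrite lin_substC.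
- rewrite lin_substXU row1 /linear_form (bigD1 i) //= mxE eqxx scale1r.
  rewrite big1 ?addr0 // => j ne_ji.
  by rewrite mxE eqxx (negPf ne_ji) scale0r.
- by rewrite !lin_substD IHf IHh.
- by rewrite !lin_substM IHf IHh.
Qed.

Lemma lin_substK (g : 'M[K]_n) : g \in unitmx ->
  cancel (lin_subst g) (lin_subst (invmx g)).
Proof. by move=> Ug f; rewrite lin_subst_comp mulmxV // lin_subst_id. Qed.

Lemma lin_substVK (g : 'M[K]_n) : g \in unitmx ->
  cancel (lin_subst (invmx g)) (lin_subst g).
Proof. by move=> Ug f; rewrite lin_subst_comp mulVmx // lin_subst_id. Qed.

Lemma msupp_lin_subst (g : 'M[K]_n) f w : w \in msupp (lin_subst g f) ->
  exists2 v, v \in msupp f & mdeg v = mdeg w.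
Proof.
rewrite {1}(mpolyE f) lin_subst_sum => /msupp_sum_le/flattenP[s /mapP[v]].
rewrite filter_predT => vf -> w_in; exists v => //.
have: (lin_subst g 'X_[v]) \is (mdeg v).-homog.
  rewrite mpolyXE_id mdegE.
  elim/big_rec2: _ => [|i k h _]; first by rewrite lin_subst1 dhomog1.
  rewrite lin_substM; apply: dhomogM.
  elim: (v i) => [|j IHj]; first by rewrite expr0 lin_subst1 dhomog1.
  rewrite exprS lin_substM -add1n; apply: dhomogM => //.
  rewrite lin_substXU; apply/dhomogP=> u; exact: msupp_linear_form.
move/dhomogP/(_ w) => ->//; move: w_in; rewrite lin_substZ; exact: msuppZ_le.
Qed.

Fixpoint in_lin_ideal Z f : Prop :=
  if Z is v :: Z' then exists a, in_lin_ideal Z' (f - linear_form v * a)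
  else f = 0.

Lemma in_lin_ideal0 Z : in_lin_ideal Z 0.
Proof. by elim: Z => //= v Z IHZ; exists 0; rewrite mulr0 subr0. Qed.

Lemma in_lin_idealD Z f h :
  in_lin_ideal Z f -> in_lin_ideal Z h -> in_lin_ideal Z (f + h).
Proof.
elim: Z f h => [f h -> ->|v Z IHZ f h /= [a fa] [b hb]]; first by rewrite addr0.
by exists (a + b); rewrite mulrDr opprD addrACA; apply: IHZ.
Qed.

Lemma in_lin_idealM Z a f : in_lin_ideal Z f -> in_lin_ideal Z (a * f).
Proof.
elim: Z f => [f ->|v Z IHZ f /= [b fb]]; first by rewrite mulr0.
by exists (a * b); rewrite mulrCA -mulrBr; apply: IHZ.
Qed.

Lemma in_lin_ideal_span Z v : v \in <<Z>>%VS -> in_lin_ideal Z (linear_form v).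
Proof.
elim: Z v => [v|u Z IHZ v] /=.
  by rewrite span_nil memv0 => /eqP->; rewrite linear_form0.
rewrite span_cons => /memv_addP[_ /vlineP[k ->] [v' v'Z ->]].
exists k%:MP; rewrite linear_formD linear_formZ mulrC mul_mpolyC.
rewrite addrAC subrr add0r.
exact: IHZ.
Qed.

(** The ideal of [Z] is the kernel of the substitution that projects along the
    span of [Z]; as polynomials have no zero divisors, a linear form outside the
    span, which the projection does not kill, is cancellable modulo the
    ideal. *)
Lemma in_lin_ideal_regular Z y h : y \notin <<Z>>%VS ->
  in_lin_ideal Z (linear_form y * h) -> in_lin_ideal Z h.
Proof.
move=> yZ; pose p := projv <<Z>>%VS.
pose P : 'M[K]_n := \matrix_i (delta_mx 0 i - p (delta_mx 0 i)).
have mulP v : v *m P = v - p v.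
  rewrite {2 3}(row_sum_delta v) linear_sum -sumrB mulmx_sum_row.
  by apply: eq_bigr => i _; rewrite rowK linearZ scalerBr.
have killP f : in_lin_ideal Z f -> lin_subst P f = 0.
  have: {subset Z <= <<Z>>%VS} by move=> v; apply: memv_span.
  elim: {1 3}Z f => [f _ -> | v Z' IHZ f sub [a fa]]; first exact: lin_subst0.
  rewrite -(subrK (linear_form v * a) f) lin_substD lin_substM.
  rewrite lin_subst_linear_form mulP projv_id ?subrr.
    rewrite linear_form0 mul0r addr0.
    by apply: IHZ => // u uZ'; apply: sub; rewrite inE uZ' orbT.
  by apply: sub; rewrite inE eqxx.
have modP f : in_lin_ideal Z (f - lin_subst P f).
  elim/mpoly_alg_ind: f => [c|i|f1 f2 IH1 IH2|f1 f2 IH1 IH2].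
  - by rewrite lin_substC subrr; apply: in_lin_ideal0.
  - have -> : 'X_i = linear_form (delta_mx 0 i).
      by rewrite -(lin_subst_id 'X_i) lin_substXU row1.
    rewrite lin_subst_linear_form mulP linear_formB subKr.
    by apply: in_lin_ideal_span; apply: memv_proj.
  - by rewrite lin_substD opprD addrACA; apply: in_lin_idealD.
  - rewrite lin_substM.
    have -> : f1 * f2 - lin_subst P f1 * lin_subst P f2 =
      f1 * (f2 - lin_subst P f2) + lin_subst P f2 * (f1 - lin_subst P f1).
      ring.
    by apply: in_lin_idealD; apply: in_lin_idealM.
move=> /killP/eqP; rewrite lin_substM mulf_eq0 lin_subst_linear_form mulP.
rewrite linear_form_eq0 subr_eq0 => /orP[/eqP y_p|/eqP h0].
  by case/negP: yZ; rewrite y_p memv_proj.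
by have := modP h; rewrite h0 subr0.
Qed.

(** * Gap ideals *)

(** For a sequence [l] of linear forms, the ideal generated modulo [Z] by the
    products l(j_1) ... l(j_p) with s <= j_1, j_p < s + c + 2p - 2 and
    consecutive indices at distance at least two; the recursion separates the
    products with j_1 = s from the others. *)
Fixpoint gap_ideal (l : nat -> 'rV[K]_n) Z (p : nat) :
    nat -> nat -> {mpoly K[n]} -> Prop :=
  if p is p'.+1 then
    fix gap_ideal_p (c : nat) (s : nat) f {struct c} : Prop :=
      if c is c'.+1 then
        exists q r, [/\ gap_ideal l Z p' c'.+1 s.+2 q,
                        gap_ideal_p c' s.+1 r & f = linear_form (l s) * q + r]
      else in_lin_ideal Z f
  else fun _ _ _ => True.

Section GapIdeal.
Variable l : nat -> 'rV[K]_n.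
Implicit Types (p c s : nat).

Lemma gap_idealE p c s Z f : gap_ideal l Z p.+1 c.+1 s f <->
  exists q r, [/\ gap_ideal l Z p c.+1 s.+2 q, gap_ideal l Z p.+1 c s.+1 r
                & f = linear_form (l s) * q + r].
Proof. by []. Qed.

Lemma gap_ideal_lin p c s Z f : in_lin_ideal Z f -> gap_ideal l Z p c s f.
Proof.
elim: p c s f => // p IHp c; elim: c => // c IHc s f Zf.
exists 0, f; split; rewrite ?mulr0 ?add0r //; last exact: IHc.
by apply: IHp; apply: in_lin_ideal0.
Qed.

Lemma gap_ideal0 p c s Z : gap_ideal l Z p c s 0.
Proof. by apply: gap_ideal_lin; apply: in_lin_ideal0. Qed.

Lemma gap_idealD p c s Z f h :
  gap_ideal l Z p c s f -> gap_ideal l Z p c s h -> gap_ideal l Z p c s (f + h).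
Proof.
elim: p c s f h => // p IHp; elim=> [|c IHc] s f h; first exact: in_lin_idealD.
move=> /gap_idealE[q [r [Qq Qr ->]]] /gap_idealE[q' [r' [Qq' Qr' ->]]].
apply/gap_idealE; exists (q + q'), (r + r').
by split; [apply: IHp | apply: IHc | ring].
Qed.

Lemma gap_idealM p c s Z a f :
  gap_ideal l Z p c s f -> gap_ideal l Z p c s (a * f).
Proof.
elim: p c s f => // p IHp; elim=> [|c IHc] s f; first exact: in_lin_idealM.
move=> /gap_idealE[q [r [Qq Qr ->]]].
apply/gap_idealE; exists (a * q), (a * r).
by split; [apply: IHp | apply: IHc | ring].
Qed.

Lemma gap_idealB p c s Z f h :
  gap_ideal l Z p c s f -> gap_ideal l Z p c s h -> gap_ideal l Z p c s (f - h).
Proof.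
by rewrite -mulN1r => Qf Qh; apply: gap_idealD => //; apply: gap_idealM.
Qed.

Lemma gap_ideal_cons p c s Z v f : gap_ideal l (v :: Z) p c s f ->
  exists a, gap_ideal l Z p c s (f - linear_form v * a).
Proof.
elim: p c s f => [|p IHp]; first by exists 0.
elim=> [|c IHc] s f; first by [].
move=> /gap_idealE[q [r [/IHp[a Qa] /IHc[b Qb] ->]]].
exists (linear_form (l s) * a + b); apply/gap_idealE.
by do 2!eexists; split; [exact: Qa | exact: Qb | ring].
Qed.

Lemma gap_ideal_consr p c s Z v f a :
  gap_ideal l Z p c s (f - linear_form v * a) -> gap_ideal l (v :: Z) p c s f.
Proof.
elim: p c s f a => [|p IHp] //; elim=> [|c IHc] s f a; first by exists a.
move=> /gap_idealE[q [r [Qq Qr /eqP]]]; rewrite subr_eq => /eqP->.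
apply/gap_idealE; exists q, (r + linear_form v * a).
split; last by rewrite addrA.
  by apply: (IHp _ _ _ 0); rewrite mulr0 subr0.
by apply: (IHc _ _ a); rewrite addrK.
Qed.

(** Dropping the first factor of a product shortens it by one and moves its
    start by two. *)
Lemma gap_ideal_drop p c s Z f :
  gap_ideal l Z p.+1 c s.+1 f -> gap_ideal l Z p c.+1 s.+2 f.
Proof.
case: p => // p; elim: c s f => [|c IHc] s f; first exact: gap_ideal_lin.
move=> /gap_idealE[q [r [Qq /IHc Qr ->]]].
apply/gap_idealE; exists 0, (linear_form (l s.+1) * q + r).
split; rewrite ?mulr0 ?add0r //; first exact: gap_ideal0.
by apply: gap_idealD => //; apply: gap_idealM.
Qed.

(** The ideals generated by gap products of forms in general position behave
    like Cohen-Macaulay ideals of codimension [c]: a further general linear form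
    is a nonzerodivisor.  Modulo the first form [l s] the products of the second
    kind remain, whose codimension is one less; and what [l s] multiplies into
    the ideal lies in the ideal of products with one factor fewer. *)
Lemma gap_ideal_regular p c s Z y h :
  (forall T, uniq T -> size T = c -> all (leq s) T ->
     all (fun j => j < s + c + 2 * p.-1)%N T ->
     free (y :: [seq l j | j <- T] ++ Z)) ->
  gap_ideal l Z p c s (linear_form y * h) -> gap_ideal l Z p c s h.
Proof.
have [k] := ubnP (p + c); elim: k p c s Z y h => // k IHk p c s Z y h.
case: p => // p; case: c => [_ GP|c].
  have := GP [::] isT erefl isT isT; rewrite free_cons => /andP[yZ _].
  exact: in_lin_ideal_regular.
rewrite ltnS => le_pc_k GP Qyh.
have wide T : uniq T -> size T = c -> all (leq s.+1) T ->
    all (fun j => j < s.+1 + c + 2 * p)%N T ->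
  free (y :: l s :: [seq l j | j <- T] ++ Z).
  move=> uT szT geT ltT; apply: (GP (s :: T)).
  - rewrite /= uT andbT; apply/negP => sT.
    by have := allP geT s sT; rewrite ltnn.
  - by rewrite /= szT.
  - by rewrite /= leqnn; apply: sub_all geT => j; apply: ltnW.
  - rewrite /=; apply/andP; split; first by lia.
    by apply: sub_all ltT => j; rewrite addnS addSn.
have [q [r [Qq Qr yhE]]] := (gap_idealE _ _ _ _ _).1 Qyh.
(* Modulo l s: here y is cancelled in the ideal with c decreased. *)
have [a Qa] : exists a, gap_ideal l Z p.+1 c s.+1 (h - linear_form (l s) * a).
  apply: gap_ideal_cons; apply: (IHk p.+1 c _ _ y); first by lia.
    move=> T uT szT geT ltT; rewrite /= in ltT.
    rewrite (@perm_free _ _ _ (y :: l s :: [seq l j | j <- T] ++ Z)) ?wide //.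
    by rewrite perm_cons -cat1s perm_catCA.
  by apply: (@gap_ideal_consr _ _ _ _ _ _ q); rewrite yhE addrC addKr.
(* It remains to show that the multiple of l s split off from h is in the
   ideal; for this l s is cancelled in turn, and then y once more. *)
have Qya : gap_ideal l Z p.+1 c.+1 s (linear_form y * (linear_form (l s) * a)).
  have -> : linear_form y * (linear_form (l s) * a) =
    linear_form y * h - linear_form y * (h - linear_form (l s) * a) by ring.
  apply: gap_idealB => //; apply/gap_idealE.
  exists 0, (linear_form y * (h - linear_form (l s) * a)).
  split; first exact: gap_ideal0; last by rewrite mulr0 add0r.
  exact: gap_idealM.
have {Qya} [q1 [r1 [Qq1 Qr1 yaE]]] := (gap_idealE _ _ _ _ _).1 Qya.
have Qd : gap_ideal l Z p.+1 c s.+1 (linear_form y * a - q1).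
  apply: (IHk p.+1 c _ _ (l s)); first by lia.
    move=> T uT szT geT ltT; have := wide T uT szT geT ltT.
    by rewrite free_cons => /andP[].
  suff -> : linear_form (l s) * (linear_form y * a - q1) = r1 by [].
  by rewrite mulrBr mulrCA yaE addrC addKr.
have Qy_a : gap_ideal l Z p c.+1 s.+2 (linear_form y * a).
  rewrite -(subrK q1 (linear_form y * a)); apply: gap_idealD => //.
  exact: gap_ideal_drop.
apply/gap_idealE; exists a, (h - linear_form (l s) * a).
split => //; last by rewrite addrC subrK.
case: p {Qyh Qq Qr Qa Qq1 Qr1 Qd wide} le_pc_k GP Qy_a => // p le_pc_k GP.
apply: (IHk p.+1 c.+1 _ _ y); first by lia.
move=> T uT szT geT ltT; apply: GP => //.
  by apply: sub_all geT => j; lia.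
by apply: sub_all ltT => j /=; lia.
Qed.

End GapIdeal.
End LinearForms.


(** * Leading monomials *)

Section DegRevLex.
Context (n : nat).
Implicit Types u v w : 'X_{1..n}.

Lemma degrevlex_irr u : degrevlex_lt u u = false.
Proof.
rewrite /degrevlex_lt ltnn eqxx /=.
by apply/negbTE/existsP=> -[i /andP[]]; rewrite ltnn.
Qed.

Lemma degrevlex_trans u v w :
  degrevlex_lt u v -> degrevlex_lt v w -> degrevlex_lt u w.
Proof.
rewrite /degrevlex_lt => /orP[lt_uv /orP[lt_vw | /andP[/eqP <- _]]|].
- by rewrite (ltn_trans lt_uv).
- by rewrite lt_uv.
case/andP=> /eqP-> /existsP[i /andP[lti /forallP eqi]] /orP[->//|/andP[->]].
case/existsP=> j /andP[ltj /forallP eqj]; apply/orP; right; rewrite andTb.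
have eqi' (k : 'I_n) : (i < k)%N -> u k = v k.
  by move=> ik; apply/eqP/(implyP (eqi k)).
have eqj' (k : 'I_n) : (j < k)%N -> v k = w k.
  by move=> jk; apply/eqP/(implyP (eqj k)).
case: (ltngtP i j) => [lt_ij|lt_ji|/ord_inj eq_ij].
- apply/existsP; exists j; rewrite (eqi' _ lt_ij) ltj.
  apply/forallP=> k; apply/implyP=> jk.
  by rewrite eqi' ?eqj' // (ltn_trans lt_ij).
- apply/existsP; exists i; rewrite -(eqj' _ lt_ji) lti.
  apply/forallP=> k; apply/implyP=> ik.
  by rewrite eqi' ?eqj' // (ltn_trans lt_ji).
- subst j; apply/existsP; exists i; rewrite (ltn_trans ltj lti).
  by apply/forallP=> k; apply/implyP=> ik; rewrite eqi' ?eqj'.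
Qed.

Lemma degrevlex_total u v : u != v -> degrevlex_lt u v || degrevlex_lt v u.
Proof.
move=> ne_uv; rewrite /degrevlex_lt; case: (ltngtP (mdeg u) (mdeg v)) => //= _.
have /existsP[i0 ne_i0] : [exists i, u i != v i].
  by apply: contraR ne_uv => /existsPn eq_uv; apply/eqP/mnmP=> i;
     apply/eqP; rewrite -[_ == _]negbK.
case: (@arg_maxnP _ i0 (fun i => u i != v i) (fun i => i : nat) ne_i0).
move=> i ne_i max_i.
have eq_gt (k : 'I_n) : (i < k)%N -> u k = v k.
  move=> ik; apply/eqP; rewrite -[_ == _]negbK; apply/negP=> /max_i /=.
  by rewrite leqNgt ik.
case: (ltngtP (v i) (u i)) => [lt_i|lt_i|eq_i].
- apply/orP; left; apply/existsP; exists i; rewrite lt_i.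
  by apply/forallP=> k; apply/implyP=> /eq_gt->.
- apply/orP; right; apply/existsP; exists i; rewrite lt_i.
  by apply/forallP=> k; apply/implyP=> /eq_gt->.
- by rewrite eq_i eqxx in ne_i.
Qed.

Lemma degrevlex_add2r w u v :
  degrevlex_lt (u + w)%MM (v + w)%MM = degrevlex_lt u v.
Proof.
rewrite /degrevlex_lt !mdegD ltn_add2r eqn_add2r; congr (_ || _ && _).
apply: eq_existsb => i; rewrite !mnmDE ltn_add2r; congr (_ && _).
by apply: eq_forallb => j; rewrite !mnmDE eqn_add2r.
Qed.

Lemma degrevlex_mdeg u v : degrevlex_lt u v -> mdeg u <= mdeg v.
Proof. by case/orP=> [/ltnW|/andP[/eqP-> _]]. Qed.

Lemma degrevlex_max (P : pred 'X_{1..n}) (s : seq 'X_{1..n}) :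
  has P s -> exists2 w, (w \in s) && P w &
    forall v, v \in s -> P v -> v != w -> degrevlex_lt v w.
Proof.
elim: s => //= u s IHs; have [Ps _|nPs] := boolP (has P s).
  have [w /andP[ws Pw] max_w] := IHs Ps.
  have [Pu|nPu] := boolP (P u); last first.
    exists w; rewrite ?inE ?ws ?orbT // => v; rewrite inE => /orP[/eqP->|].
      by rewrite (negPf nPu).
    exact: max_w.
  have [->|ne_uw] := eqVneq u w.
    exists w; rewrite ?inE ?eqxx // => v; rewrite inE => /orP[/eqP->|].
      by rewrite eqxx.
    exact: max_w.
  case/orP: (degrevlex_total ne_uw) => [lt_uw|lt_wu].
    exists w; rewrite ?inE ?ws ?orbT // => v; rewrite inE => /orP[/eqP->//|].
    exact: max_w.
  exists u; rewrite ?inE ?eqxx // => v; rewrite inE => /orP[/eqP->|vs Pv _].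
    by rewrite eqxx.
  have [->//|ne_vw] := eqVneq v w.
  exact: degrevlex_trans (max_w v vs Pv ne_vw) lt_wu.
rewrite orbF => Pu; exists u; rewrite ?inE ?eqxx // => v.
rewrite inE => /orP[/eqP->|vs Pv]; first by rewrite eqxx.
by case/hasP: nPs; exists v.
Qed.

End DegRevLex.

Section LeadingMonomials.
Import Order.TTheory GRing.Theory.
Local Open Scope ring_scope.
Context (K : fieldType) (n : nat).
Implicit Types (f h a : {mpoly K[n]}) (u v w : 'X_{1..n}).

Lemma lead_mon_exists f : f != 0 -> exists w, is_lead_mon f w.
Proof.
rewrite -msupp_eq0 => f_neq0; have : has predT (msupp f).
  by rewrite has_predT lt0n size_eq0.
case/degrevlex_max=> w /andP[wf _] max_w; exists w; split=> // v vf.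
exact: max_w.
Qed.

Lemma lead_monM f w u : is_lead_mon f w -> is_lead_mon (f * 'X_[u]) (w + u)%MM.
Proof.
case=> wf max_w; split=> [|v]; rewrite (perm_mem (msuppMX _ _)).
  by rewrite addmC; apply: map_f.
case/mapP=> v' v'f ->; rewrite addmC eqm_add2r degrevlex_add2r; exact: max_w.
Qed.

(** The largest leading monomial with a nonzero coefficient cannot cancel. *)
Lemma lead_mon_free (I : finType) (F : I -> {mpoly K[n]}) (w : I -> 'X_{1..n})
    (k : I -> K) :
  injective w -> (forall i, is_lead_mon (F i) (w i)) ->
  \sum_i k i *: F i = 0 -> forall i, k i = 0.
Proof.
move=> w_inj leadF sum0; have [//|] := boolP [forall i, k i == 0].
  by move/forallP=> k0 i; apply/eqP.
case/forallPn=> i0 ki0.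
have : has (fun v => [exists i, (w i == v) && (k i != 0)])
    [seq w i | i <- enum I].
  apply/hasP; exists (w i0); first by rewrite map_f ?mem_enum.
  by apply/existsP; exists i0; rewrite eqxx.
case/degrevlex_max=> _ /andP[_ /existsP[i /andP[/eqP<- ki]]] max_wi.
move/(congr1 (mcoeff (w i))): sum0; rewrite mcoeff0 raddf_sum (bigD1 i) //=.
rewrite big1 => [|j ne_ji].
  rewrite addr0 mcoeffZ => /eqP; rewrite mulf_eq0 (negPf ki) mcoeff_eq0.
  by case: (leadF i) => ->.
rewrite mcoeffZ; have [->|kj] := eqVneq (k j) 0; first by rewrite mul0r.
rewrite memN_msupp_eq0 ?mulr0 //; apply/negP=> wi_Fj.
have lt_ji : degrevlex_lt (w j) (w i).
  apply: max_wi; first by rewrite map_f ?mem_enum.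
    by apply/existsP; exists j; rewrite eqxx.
  by rewrite (inj_eq w_inj).
have /(degrevlex_trans lt_ji) : degrevlex_lt (w i) (w j).
  by case: (leadF j) => _; apply=> //; rewrite (inj_eq w_inj) eq_sym.
by rewrite degrevlex_irr.
Qed.

(** More polynomials than there are spanning elements satisfy a linear relation,
    which distinct leading monomials exclude. *)
Lemma lead_mon_card (I J : finType) (F : I -> {mpoly K[n]})
    (w : I -> 'X_{1..n}) (b : J -> {mpoly K[n]}) (c : I -> J -> K) :
  injective w -> (forall i, is_lead_mon (F i) (w i)) ->
  (forall i, F i = \sum_j c i j *: b j) -> (#|I| <= #|J|)%N.
Proof.
move=> w_inj leadF FE; rewrite leqNgt; apply/negP=> lt_JI.
pose M : 'M[K]_(#|I|, #|J|) := \matrix_(i, j) c (enum_val i) (enum_val j).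
have : ~~ row_free M.
  by rewrite /row_free neq_ltn (leq_ltn_trans (rank_leq_col M)).
rewrite -kermx_eq0 => /rowV0Pn[v /sub_kermxP vM v_neq0].
case/eqP: v_neq0; apply/rowP=> i0; rewrite mxE.
rewrite -(enum_valK i0); move: (enum_val i0).
apply: (lead_mon_free w_inj leadF (k := fun i => v ord0 (enum_rank i))).
under eq_bigr do rewrite FE scaler_sumr.
rewrite exchange_big big1 // => j _.
under eq_bigr do rewrite scalerA.
rewrite -scaler_suml (_ : \sum_i _ = (v *m M) ord0 (enum_rank j)).
  by rewrite vM mxE scale0r.
rewrite mxE (reindex (@enum_rank I)); last first.
  by apply: onW_bij; apply: enum_rank_bij.
by apply: eq_bigr => i _; rewrite mxE !enum_rankK.
Qed.

(** The vanishing of the coefficients at all monomials [w j] but one imposes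
    fewer conditions than the dimension, so some nonzero element satisfies them; its
    leading monomial can only be the remaining one. *)
Lemma lead_mon_onto (I : finType) (F : I -> {mpoly K[n]})
    (J : finType) (w : J -> 'X_{1..n}) :
  (forall k : I -> K, \sum_i k i *: F i = 0 -> forall i, k i = 0) ->
  (forall (k : I -> K) v, is_lead_mon (\sum_i k i *: F i) v ->
     exists j, v = w j) ->
  (#|J| <= #|I|)%N ->
  forall j0, exists k : I -> K, is_lead_mon (\sum_i k i *: F i) (w j0).
Proof.
move=> freeF leadF le_JI j0.
pose M : 'M[K]_(#|I|, #|J|.-1) :=
  \matrix_(i, j) (F (enum_val i))@_(w (nth j0 (rem j0 (enum J)) j)).
have J_gt0 : (0 < #|J|)%N by apply/card_gt0P; exists j0.
have : ~~ row_free M.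
  rewrite /row_free neq_ltn (leq_ltn_trans (rank_leq_col M)) //.
  by rewrite prednK // in le_JI *.
rewrite -kermx_eq0 => /rowV0Pn[x /sub_kermxP xM x_neq0].
pose k i := x ord0 (enum_rank i); exists k.
have sum_neq0 : \sum_i k i *: F i != 0.
  apply: contra x_neq0 => /eqP/freeF k0; apply/eqP/rowP=> i.
  by rewrite mxE -(enum_valK i); apply: k0.
have [v lead_v] := lead_mon_exists sum_neq0.
have [j v_wj] := leadF _ _ lead_v; have [<-|ne_j] := eqVneq j j0.
  by rewrite -v_wj.
have rem_sz : size (rem j0 (enum J)) = #|J|.-1.
  by rewrite size_rem ?mem_enum // -cardE.
have j_in : j \in rem j0 (enum J).
  by rewrite mem_rem_uniq ?enum_uniq // !inE ne_j mem_enum.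
have lt_j : (index j (rem j0 (enum J)) < #|J|.-1)%N.
  by rewrite -rem_sz index_mem.
case: lead_v => + _; rewrite v_wj mcoeff_msupp => /eqP[].
have /rowP/(_ (Ordinal lt_j)) := xM; rewrite !mxE => <-.
rewrite raddf_sum [RHS](reindex (@enum_rank I)) /=; last first.
  by apply: onW_bij; apply: enum_rank_bij.
by apply: eq_bigr => i _; rewrite mxE mcoeffZ enum_rankK /= nth_index.
Qed.

End LeadingMonomials.

Section GapIdealLead.
Import Order.TTheory GRing.Theory.
Local Open Scope ring_scope.
Context (K : fieldType) (n : nat).
Implicit Types (f h a : {mpoly K[n]}) (u v w : 'X_{1..n}) (c t p : nat).

Definition var_row (j : nat) : 'rV[K]_n := \row_(i < n) (i == j :> nat)%:R.

Lemma linear_form_var (i : 'I_n) : linear_form (var_row i) = 'X_i.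
Proof.
rewrite /linear_form (bigD1 i) //= mxE eqxx scale1r big1 ?addr0 // => j ne_ji.
by rewrite mxE (inj_eq (@ord_inj n)) (negPf ne_ji) scale0r.
Qed.

Definition tail_rows t : seq 'rV[K]_n := [seq var_row j | j <- iota t (n - t)].

Definition vanishes_from t w : bool :=
  [forall i : 'I_n, (t <= i)%N ==> (w i == 0%N)].

Lemma vanishes_fromP t w :
  reflect (forall i : 'I_n, (t <= i)%N -> w i = 0%N) (vanishes_from t w).
Proof.
apply: (iffP forallP) => [w0 i le_ti|w0 i]; first exact/eqP/(implyP (w0 i)).
by apply/implyP=> /w0->.
Qed.

Lemma in_tail_ideal t v : ~~ vanishes_from t v ->
  in_lin_ideal (tail_rows t) ('X_[v] : {mpoly K[n]}).
Proof.
case/forallPn=> i; rewrite negb_imply => /andP[le_ti vi].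
rewrite -(@submK _ U_(i)%MM v) ?lep1mP // mpolyXD -linear_form_var.
apply: in_lin_idealM; apply: in_lin_ideal_span; apply: memv_span.
by apply: map_f; rewrite mem_iota le_ti; move: (ltn_ord i) le_ti; lia.
Qed.

Lemma in_tail_ideal_supp t f v : in_lin_ideal (tail_rows t) f ->
  v \in msupp f -> ~~ vanishes_from t v.
Proof.
rewrite /tail_rows; have : all (fun j => (t <= j < n)%N) (iota t (n - t)).
  by apply/allP=> j; rewrite mem_iota; lia.
elim: (iota _ _) f => [f _ ->|j s IHs f /=]; first by rewrite msupp0.
move=> /andP[/andP[le_tj lt_jn] s_ok] [a fa].
rewrite -(subrK (linear_form (var_row j) * a) f) => /msuppD_le.
rewrite mem_cat => /orP[|]; first exact: IHs.
rewrite (linear_form_var (Ordinal lt_jn)) mulrC (perm_mem (msuppMX _ _)).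
case/mapP=> u _ ->; apply/negP=> /vanishes_fromP/(_ (Ordinal lt_jn) le_tj).
by rewrite mnmDE mnm1E eqxx.
Qed.

Variable l : nat -> 'rV[K]_n.

Lemma gap_ideal_mdeg c p c' s f w : gap_ideal l (tail_rows c) p c' s f ->
  w \in msupp f -> vanishes_from c w -> (p <= mdeg w)%N.
Proof.
elim: p c' s f w => // p IHp; elim=> [|c' IHc] s f w.
  by move=> /in_tail_ideal_supp Zf /Zf/negPf->.
move=> /gap_idealE[q [r [Qq Qr ->]]] /msuppD_le.
rewrite mem_cat => /orP[|w_r]; last exact: IHc Qr w_r.
case/msuppM_le/allpairsP=> -[m1 m2] /= [m1l m2q ->] w0.
rewrite mdegD (msupp_linear_form m1l) ltnS; apply: IHp Qq m2q _.
apply/vanishes_fromP=> i le_ci; have /vanishes_fromP/(_ i le_ci) := w0.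
by rewrite mnmDE => /eqP; rewrite addn_eq0 => /andP[_ /eqP].
Qed.

Lemma gap_ideal_sub Z (y : 'rV[K]_n) p c s f :
  gap_ideal l Z p c s f -> gap_ideal l (y :: Z) p c s f.
Proof.
move=> Qf; apply: (@gap_ideal_consr _ _ _ _ _ _ _ _ _ 0).
by rewrite mulr0 subr0.
Qed.

(** The last remaining variable is a nonzerodivisor modulo the gap ideal, so a
    leading monomial that it divides can be divided by it; otherwise the variable
    may be set to zero.  Once only the first [c] variables remain, every element
    of the gap ideal has order at least [p]. *)
Lemma gap_ideal_lead_mod c p f w k t : (c <= t <= n)%N ->
  (forall T, uniq T -> size T = c -> all (fun j => j < c + 2 * p.-1)%N T ->
     free ([seq l j | j <- T] ++ tail_rows c)) ->
  gap_ideal l (tail_rows t) p c 0 f ->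
  (forall v, v \in msupp f -> vanishes_from t v -> mdeg v = k) ->
  w \in msupp f -> vanishes_from t w ->
  (forall v, v \in msupp f -> vanishes_from t v -> v != w ->
     degrevlex_lt v w) ->
  (p <= \sum_(i < n | (i < c)%N) w i)%N.
Proof.
move=> /andP[le_ct le_tn] GP; rewrite -(subnKC le_ct) in le_tn *.
elim: (t - c)%N le_tn f w k => {t le_ct} [|e IHe] le_tn f w k Qf homf wf w0
  max_w.
  rewrite addn0 in Qf w0; have := gap_ideal_mdeg Qf wf w0.
  rewrite mdegE (bigID (fun i : 'I_n => (i < c)%N)) /=.
  rewrite [X in (_ + X)%N]big1 ?addn0 // => i; rewrite -leqNgt.
  by move/(vanishes_fromP _ _ w0).
rewrite addnS in le_tn Qf homf w0 max_w.
set t := (c + e)%N in IHe le_tn Qf homf w0 max_w.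
have tailE : tail_rows t = var_row t :: tail_rows t.+1.
  by rewrite /tail_rows -subnSK.
pose ot := Ordinal le_tn.
move Ea : (w ot) => m; elim: m k f w Ea Qf homf wf w0 max_w => [|m IHm] k f w
  Ea Qf homf wf w0 max_w.
  have van v : vanishes_from t v -> vanishes_from t.+1 v.
    by move/vanishes_fromP=> v0; apply/vanishes_fromP=> i /ltnW/v0.
  apply: (IHe (ltnW le_tn) f w k) => //.
  - by rewrite tailE; apply: gap_ideal_sub.
  - by move=> v vf /van; apply: homf.
  - apply/vanishes_fromP=> i; rewrite leq_eqVlt => /orP[/eqP eq_ti|].
      by rewrite -Ea; congr (w _); apply: val_inj.
    exact/vanishes_fromP.
  - by move=> v vf /van; apply: max_w.
(* In the reverse lexicographic order the monomials below w are divisible by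
   the last variable when w is. *)
have div v : v \in msupp f -> vanishes_from t.+1 v -> (U_(ot) <= v)%MM.
  move=> vf v0; rewrite lep1mP -lt0n; have [->|ne_vw] := eqVneq v w.
    by rewrite Ea.
  have := max_w v vf v0 ne_vw; rewrite /degrevlex_lt (homf v) // (homf w) //.
  rewrite ltnn eqxx /= => /existsP[i /andP[lt_i /forallP eq_i]].
  case: (ltngtP i t) => [lt_it|lt_ti|eq_it].
  - by have /implyP/(_ lt_it)/eqP -> := eq_i ot; rewrite Ea.
  - by rewrite (vanishes_fromP _ _ v0) in lt_i.
  - by rewrite (_ : ot = i) ?(leq_ltn_trans _ lt_i) //; apply: val_inj.
(* The part of f without later variables, divided by X_t. *)
pose f' : {mpoly K[n]} :=
  \sum_(v <- msupp f | vanishes_from t.+1 v) f@_v *: 'X_[v - U_(ot)].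
have f'X : f' * 'X_ot =
    \sum_(v <- msupp f | vanishes_from t.+1 v) f@_v *: 'X_[v].
  rewrite mulr_suml big_seq_cond [RHS]big_seq_cond.
  apply: eq_bigr => v /andP[vf v0].
  by rewrite -scalerAl -mpolyXD submK ?div.
have coef_f' v : f'@_v =
    if vanishes_from t.+1 (v + U_(ot)) then f@_(v + U_(ot)) else 0.
  rewrite -(mcoeffMX f' U_(ot)) addmC f'X raddf_sum /=.
  case: ifP => v0; last first.
    rewrite big1 // => u u0; rewrite mcoeffZ mcoeffX.
    by case: eqP u0 => [->|]; rewrite ?v0 ?mulr0.
  have [v_in|v_notin] := boolP ((v + U_(ot))%MM \in msupp f).
    rewrite big_mkcond (bigD1_seq _ v_in) ?msupp_uniq //= v0 mcoeffZ mcoeffX.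
    rewrite eqxx mulr1 big1 ?addr0 // => u ne_u; case: ifP => // _.
    by rewrite mcoeffZ mcoeffX (negPf ne_u) mulr0.
  rewrite memN_msupp_eq0 // big_seq_cond big1 // => u /andP[uf _].
  rewrite mcoeffZ mcoeffX; case: eqP uf => [->|]; rewrite ?mulr0 //.
  by rewrite (negPf v_notin).
have supp_f' v : (v \in msupp f') =
    ((v + U_(ot))%MM \in msupp f) && vanishes_from t.+1 (v + U_(ot)).
  rewrite !mcoeff_msupp coef_f'; case: ifP => _; rewrite ?andbT ?eqxx ?andbF //.
have vanD v : vanishes_from t.+1 (v + U_(ot)) = vanishes_from t.+1 v.
  apply: eq_forallb => i; case: ltnP => //= lt_ti; rewrite mnmDE mnm1E.
  by rewrite -val_eqE /= (ltn_eqF lt_ti) addn0.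
have w_div : (w - U_(ot) + U_(ot))%MM = w by rewrite submK ?div.
have -> : \sum_(i < n | (i < c)%N) w i =
    \sum_(i < n | (i < c)%N) (w - U_(ot))%MM i.
  apply: eq_bigr => i lt_ic; rewrite mnmBE mnm1E -val_eqE /= gtn_eqF ?subn0 //.
  exact: leq_trans lt_ic (leq_addr _ _).
apply: (IHm k.-1 f') => //.
- by rewrite mnmBE mnm1E eqxx Ea subn1.
- apply: (@gap_ideal_regular _ _ _ _ _ _ _ (var_row t)).
    move=> T uT szT _ ltT; have := GP T uT szT ltT.
    have -> : tail_rows c = [seq var_row j | j <- iota c e] ++ tail_rows t.
      rewrite /tail_rows -map_cat -/t -iotaD; congr (map _ (iota _ _)).
      by move: (le_tn); rewrite /t; lia.
    rewrite tailE => freeT.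
    have : free ([seq var_row j | j <- iota c e] ++
        var_row t :: [seq l j | j <- T] ++ tail_rows t.+1).
      rewrite (perm_free (Y := [seq l j | j <- T] ++
        [seq var_row j | j <- iota c e] ++ var_row t :: tail_rows t.+1)) //.
      by rewrite perm_sym perm_catCA perm_cat2l -cat1s perm_catCA.
    by move/catr_free.
  have -> : linear_form (var_row t) * f' =
      f - \sum_(v <- msupp f | ~~ vanishes_from t.+1 v) f@_v *: 'X_[v].
    rewrite (linear_form_var ot) mulrC f'X.
    apply/eqP; rewrite eq_sym subr_eq; apply/eqP.
    by rewrite {1}(mpolyE f) (bigID (vanishes_from t.+1)).
  apply: gap_idealB => //; apply: gap_ideal_lin.
  apply: big_ind => [||v v0]; first exact: in_lin_ideal0.
    exact: in_lin_idealD.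
  by rewrite -mul_mpolyC; apply: in_lin_idealM; apply: in_tail_ideal.
- move=> v; rewrite supp_f' => /andP[vf v0] _.
  by rewrite -(homf _ vf v0) mdegD mdeg1 addn1.
- by rewrite supp_f' w_div wf.
- by rewrite -vanD w_div.
- move=> v; rewrite supp_f' => /andP[vf v0] _ ne_v.
  rewrite -(degrevlex_add2r U_(ot)) w_div max_w //.
  by rewrite -w_div eqm_add2r.
Qed.

Lemma gap_ideal_lead c p k f w : (c <= n)%N ->
  (forall T, uniq T -> size T = c -> all (fun j => j < c + 2 * p.-1)%N T ->
     free ([seq l j | j <- T] ++ tail_rows c)) ->
  gap_ideal l [::] p c 0 f -> (forall v, v \in msupp f -> mdeg v = k) ->
  is_lead_mon f w -> (p <= \sum_(i < n | (i < c)%N) w i)%N.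
Proof.
move=> le_cn GP Qf homf [wf max_w]; have tail_nil : tail_rows n = [::].
  by rewrite /tail_rows subnn.
apply: (gap_ideal_lead_mod (f := f) (k := k) (t := n)) => //.
- by rewrite le_cn leqnn.
- by rewrite tail_nil.
- by move=> v vf _; apply: homf.
- by apply/vanishes_fromP=> i; rewrite leqNgt ltn_ord.
- by move=> v vf _; apply: max_w.
Qed.

End GapIdealLead.


(** * Monomials as index sequences *)

Section IndexSequences.
Implicit Types (n m : nat) (s t : seq nat).

Definition index_seq n s : bool := sorted leq s && all (fun j => 0 < j <= n) s.

Definition mon_of n s : 'X_{1..n} := [multinom count_mem i.+1 s | i < n].

Lemma count_indices n (u : 'X_{1..n}) (P : pred nat) :
  count P (indices u) = \sum_(i < n | P i.+1) u i.
Proof.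
rewrite /indices count_flatten -map_comp sumnE big_map big_enum /=.
rewrite [RHS]big_mkcond; apply: eq_bigr => i _.
by rewrite count_nseq; case: (P _); rewrite ?mul1n ?mul0n.
Qed.

Lemma size_indices n (u : 'X_{1..n}) : size (indices u) = mdeg u.
Proof. by rewrite -count_predT count_indices mdegE. Qed.

Lemma index_seq_indices n (u : 'X_{1..n}) : index_seq n (indices u).
Proof.
apply/andP; split; last first.
  apply/allP=> j /flattenP[_ /mapP[i _ ->]]; rewrite mem_nseq.
  by case/andP=> _ /eqP->; rewrite ltn_ord.
rewrite /indices sorted_pairwise; last exact: leq_trans.
have : sorted ltn (map val (enum 'I_n)).
  by rewrite val_enum_ord; apply: iota_ltn_sorted.
elim: (enum 'I_n) => //= i s IHs; rewrite path_sortedE; last exact: ltn_trans.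
case/andP=> /allP lt_i sorted_s; rewrite pairwise_cat IHs // andbT.
apply/andP; split; last first.
  by elim: (u i) => //= k ->; rewrite andbT; apply/allP=> j /nseqP[->].
apply/allrelP=> _ y /nseqP[-> _] /flattenP[_ /mapP[k ks ->]] /nseqP[-> _].
by apply: ltnW; apply: lt_i; apply: map_f.
Qed.

Lemma mon_ofK n (u : 'X_{1..n}) : mon_of n (indices u) = u.
Proof.
apply/mnmP=> i; rewrite mnmE count_indices (eq_bigl (pred1 i)) ?big_pred1_eq //.
Qed.

Lemma indices_mon_of n s : index_seq n s -> indices (mon_of n s) = s.
Proof.
case/andP=> sorted_s /allP s_n.
have /andP[sorted_i /allP i_n] := index_seq_indices (mon_of n s).
apply: (sorted_eq leq_trans anti_leq) => //; apply/allP=> j.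
rewrite mem_cat => j_in.
have /andP[j_gt0 le_jn] : 0 < j <= n by case/orP: j_in => [/i_n|/s_n].
case: j j_gt0 le_jn {j_in} => // j _ lt_jn /=.
rewrite count_indices (eq_bigl (pred1 (Ordinal lt_jn))) ?big_pred1_eq ?mnmE //.
Qed.

Lemma mon_of_lem n s t :
  (forall j, count_mem j s <= count_mem j t) -> (mon_of n s <= mon_of n t)%MM.
Proof. by move=> le_st; apply/mnm_lepP=> i; rewrite !mnmE. Qed.

Lemma mon_of_take n s k : (mon_of n (take k s) <= mon_of n s)%MM.
Proof.
by apply: mon_of_lem => j; rewrite -{2}(cat_take_drop k s) count_cat leq_addr.
Qed.

Lemma index_seq_take n s k : index_seq n s -> index_seq n (take k s).
Proof.
case/andP=> sorted_s s_n; rewrite /index_seq take_sorted //=.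
by move: s_n; rewrite -{1}(cat_take_drop k s) all_cat => /andP[].
Qed.

Lemma index_seq_widen m n s : m <= n -> index_seq m s -> index_seq n s.
Proof.
move=> le_mn /andP[sorted_s s_m]; rewrite /index_seq sorted_s /=.
by apply: sub_all s_m => j; lia.
Qed.

Lemma mon_embed_mon_of m n s : index_seq m s ->
  mon_embed n (mon_of m s) = mon_of n s.
Proof.
case/andP=> _ /allP s_m; apply/mnmP=> i; rewrite !mnmE.
case: insubP => [j _ ij|]; first by rewrite /= mnmE ij.
rewrite -leqNgt => le_mi /=; apply/esym/count_memPn; apply/negP=> /s_m.
by rewrite /= ltnNge le_mi.
Qed.

Lemma leq_count_sorted s p c : sorted leq s -> p < size s ->
  (nth 0 s p <= c) = (p < count (fun j => j <= c) s).
Proof.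
elim: s p => //= x s IHs [|p] path_s lt_p.
  case: (leqP x c) => //= lt_cx; apply/esym/negbTE; rewrite -leqNgt leqn0.
  rewrite add0n -leqn0 leqNgt -has_count; apply/hasPn=> j js.
  rewrite -ltnNge; apply: leq_trans lt_cx _.
  by move: path_s; rewrite (path_sortedE leq_trans) => /andP[/allP/(_ j js)].
rewrite /= IHs //; last exact: path_sorted path_s.
case: (leqP x c) => //= lt_cx; rewrite add0n.
have -> : count (fun j => j <= c) s = 0.
  apply/eqP; rewrite -leqn0 leqNgt -has_count; apply/hasPn=> j js.
  rewrite -ltnNge; apply: leq_trans lt_cx _.
  by move: path_s; rewrite (path_sortedE leq_trans) => /andP[/allP/(_ j js)].
by [].
Qed.

Lemma size_alpha2 s : size (alpha2_indices s) = size s.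
Proof. by rewrite size_map size_iota. Qed.

Lemma nth_alpha2 s p : p < size s ->
  nth 0 (alpha2_indices s) p = nth 0 s p + 2 * p.
Proof. by move=> lt_p; rewrite (nth_map 0) ?size_iota // nth_iota. Qed.

Lemma alpha2_inj : injective alpha2_indices.
Proof.
move=> s t eq_st; have sz_st : size s = size t.
  by rewrite -size_alpha2 eq_st size_alpha2.
apply: (eq_from_nth (x0 := 0)) => // p lt_p.
have := nth_alpha2 lt_p; rewrite eq_st nth_alpha2 -?sz_st //.
by move/addIn.
Qed.

Lemma alpha2_take s k : alpha2_indices (take k s) = take k (alpha2_indices s).
Proof.
have sz : size (alpha2_indices (take k s)) = size (take k (alpha2_indices s)).
  by rewrite size_alpha2 !size_take size_alpha2.
apply: (eq_from_nth (x0 := 0)) => // p; rewrite size_alpha2 => lt_p.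
move: (lt_p); rewrite size_take_min leq_min => /andP[lt_pk lt_ps].
by rewrite nth_alpha2 // !nth_take // nth_alpha2.
Qed.

Definition alpha2_image n (v : 'X_{1..n}) : 'X_{1..n} :=
  mon_of n (alpha2_indices (indices v)).

Definition gap2 (x y : nat) : bool := x + 2 <= y.

Lemma alpha2_gap s : sorted leq s -> sorted gap2 (alpha2_indices s).
Proof.
move/(sortedP 0)=> sorted_s; apply/(sortedP 0)=> p; rewrite size_alpha2 => lt_p.
rewrite /gap2 !nth_alpha2 ?(ltnW lt_p) //.
by have := sorted_s p lt_p; lia.
Qed.

Lemma index_seq_alpha2 n s : index_seq n s ->
  (forall p, p < size s -> nth 0 s p + 2 * p <= n) ->
  index_seq n (alpha2_indices s).
Proof.
case/andP=> sorted_s /all_nthP s_n le_n; apply/andP; split.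
  by apply: sub_sorted (alpha2_gap sorted_s) => x y; rewrite /gap2; lia.
apply/(all_nthP 0)=> p; rewrite size_alpha2 => lt_p; rewrite nth_alpha2 //.
by rewrite le_n // andbT addn_gt0; case/andP: (s_n 0 p lt_p) => ->.
Qed.

End IndexSequences.

(** * The complement of a shifted order ideal *)

Section Outside.
Context (m : nat) (U : 'X_{1..m} -> Prop) (Ush : shifted_order_ideal U).
Implicit Types s t : seq nat.

Definition outside s : Prop := index_seq m s /\ ~ U (mon_of m s).

Lemma outside_indices (u : 'X_{1..m}) : ~ U u -> outside (indices u).
Proof. by move=> nUu; split; [apply: index_seq_indices | rewrite mon_ofK]. Qed.

Lemma outside_neq0 s : outside s -> 0 < size s.
Proof.
case: s => // -[_ []]; rewrite (_ : mon_of m [::] = 0%MM); first exact: soi_one.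
by apply/mnmP=> i; rewrite !mnmE.
Qed.

Lemma outside_le s t : outside s -> index_seq m t -> size s <= size t ->
  (forall p, p < size s -> nth 0 t p <= nth 0 s p) -> outside t.
Proof.
move=> [s_m nUs] t_m le_sz le_ts; split=> // Ut; apply: nUs.
apply: (soi_shift Ush (u := mon_of m (take (size s) t))).
  by apply: (soi_div Ush Ut); exact: mon_of_take.
rewrite /mon_shift_le !indices_mon_of ?index_seq_take // all2E size_takel //.
rewrite eqxx /=; apply/(all_nthP (0, 0)) => p.
rewrite size_zip size_takel // minnn => lt_p.
by rewrite nth_zip ?size_takel //= nth_take // le_ts.
Qed.

Lemma outside_min s : outside s ->
  exists k, [/\ k <= size s, outside (take k s) & ~ outside (take k.-1 s)].
Proof.
have min_k k : k <= size s -> outside (take k s) ->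
    exists k',
      [/\ k' <= size s, outside (take k' s) & ~ outside (take k'.-1 s)].
  elim: k => [|k IHk] le_k k_out.
    by have := outside_neq0 k_out; rewrite take0.
  have [k'_out|k'_in] := classic (outside (take k s)); last by exists k.+1.
  exact: IHk (ltnW le_k) k'_out.
by move=> s_out; apply: (min_k (size s)); rewrite ?take_size.
Qed.

Variable n : nat.
Hypothesis le_mn : m <= n.

Lemma mon_embed_indices (u : 'X_{1..m}) : mon_embed n u = mon_of n (indices u).
Proof. by rewrite -{1}(mon_ofK u) mon_embed_mon_of // index_seq_indices. Qed.

(** The monomials of I(U), as an ideal of the larger polynomial ring. *)
Definition outside_mon (w : 'X_{1..n}) : Prop :=
  exists2 s, outside s & (mon_of n s <= w)%MM.

(** In terms of exponents, the condition on [w] says that the first indices of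
    [w] are at most those of [s]. *)
Lemma outside_mon_dominate s (w : 'X_{1..n}) : outside s ->
  (forall p, p < size s -> p < \sum_(i < n | i < nth 0 s p) w i) ->
  outside_mon w.
Proof.
move=> s_out dom; have [/andP[_ /all_nthP s_m] _] := s_out.
have /andP[sorted_w w_n] := index_seq_indices w.
have le_sz : size s <= size (indices w).
  have := outside_neq0 s_out; case: (size s) dom => // k dom _.
  apply: leq_trans (dom k (ltnSn k)) _.
  rewrite -(count_indices w (fun j => j <= nth 0 s k)); exact: count_size.
have le_nth p : p < size s -> nth 0 (indices w) p <= nth 0 s p.
  move=> lt_p; have lt_pw := leq_trans lt_p le_sz.
  by rewrite leq_count_sorted // count_indices; apply: dom.
exists (take (size s) (indices w)); last first.
  by rewrite -{2}(mon_ofK w) mon_of_take.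
apply: (outside_le s_out); rewrite ?size_takel //; last first.
  by move=> p lt_p; rewrite nth_take // le_nth.
apply/andP; split; first exact: take_sorted.
apply/(all_nthP 0)=> p; rewrite size_takel // => lt_p; rewrite nth_take //.
have /(all_nthP 0)/(_ p (leq_trans lt_p le_sz))/andP[-> _] := w_n.
rewrite andTb; apply: leq_trans (le_nth p lt_p) _.
by case/andP: (s_m 0 p lt_p).
Qed.

Lemma outside_mon_le (w w' : 'X_{1..n}) :
  outside_mon w -> (w <= w')%MM -> outside_mon w'.
Proof.
by move=> [s s_out le_sw] le_ww'; exists s => //; apply: lepm_trans le_ww'.
Qed.

Lemma nth_le_of_lem s t : index_seq n s -> index_seq n t ->
  (mon_of n t <= mon_of n s)%MM ->
  size t <= size s /\ forall p, p < size t -> nth 0 s p <= nth 0 t p.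
Proof.
move=> s_n t_n /mnm_lepP le_ts.
have count_le (P : pred nat) : count P t <= count P s.
  rewrite -(indices_mon_of t_n) -(indices_mon_of s_n) !count_indices.
  exact: leq_sum.
have le_sz : size t <= size s by rewrite -!count_predT.
split=> // p lt_p; have [/andP[sorted_s _] /andP[sorted_t _]] := conj s_n t_n.
rewrite leq_count_sorted //; last exact: leq_trans lt_p le_sz.
by apply: leq_trans (count_le _); rewrite -leq_count_sorted.
Qed.

(** Prefixes of an index sequence are the smallest among its divisors of given
    degree, so a shortest prefix outside U is a minimal generator. *)
Lemma outside_min_gen s : outside s -> ~ outside (take (size s).-1 s) ->
  forall v, outside_mon v -> (v <= mon_of n s)%MM -> v = mon_of n s.
Proof.
move=> s_out pre_in v [t t_out le_tv] le_vs; have [s_m _] := s_out.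
have [t_m _] := t_out.
have s_n := index_seq_widen le_mn s_m; have t_n := index_seq_widen le_mn t_m.
have [le_sz le_nth] := nth_le_of_lem s_n t_n (lepm_trans le_tv le_vs).
have eq_sz : size t = size s.
  apply/eqP; rewrite eqn_leq le_sz leqNgt; apply/negP=> lt_ts; apply: pre_in.
  have sz_pre : size (take (size s).-1 s) = (size s).-1.
    by rewrite size_takel ?leq_pred.
  apply: (outside_le t_out); rewrite ?index_seq_take ?sz_pre //; first by lia.
  by move=> p lt_p; rewrite nth_take ?le_nth //; lia.
have deg_of r : index_seq n r -> mdeg (mon_of n r) = size r.
  by move=> r_n; rewrite -size_indices indices_mon_of.
have /eqP : mdeg (mon_of n s - v)%MM = 0.
  have := mdegD (mon_of n s - v)%MM v; rewrite submK // deg_of //.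
  have := mdegD (v - mon_of n t)%MM (mon_of n t).
  by rewrite submK // deg_of //; lia.
by rewrite mdeg_eq0 => /eqP eq0; rewrite -(submK le_vs) eq0 add0m.
Qed.

(** The monomials of alpha^2(I(U)); applying alpha^2 to all monomials outside U
    instead of the minimal ones gives the same ideal, as alpha^2 is compatible
    with taking prefixes. *)
Definition alpha2_mon (w : 'X_{1..n}) : Prop :=
  exists s, [/\ outside s, index_seq n (alpha2_indices s)
              & (mon_of n (alpha2_indices s) <= w)%MM].

Lemma alpha2_mon_le (w w' : 'X_{1..n}) :
  alpha2_mon w -> (w <= w')%MM -> alpha2_mon w'.
Proof.
move=> [s [s_out s_n le_sw]] le_ww'; exists s; split=> //.
exact: lepm_trans le_ww'.
Qed.

Lemma index_seq_alpha2P s : index_seq n (alpha2_indices s) ->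
  forall p, p < size s -> nth 0 s p + 2 * p <= n.
Proof.
case/andP=> _ /all_nthP s_n p lt_p; rewrite -nth_alpha2 //.
by have := s_n 0 p; rewrite size_alpha2 => /(_ lt_p)/andP[].
Qed.

End Outside.

(** * Faces of the squeezed ball *)

Section SqueezedBall.
Context (n d : nat) (U : 'X_{1..n - d - 1} -> Prop).
Hypothesis (Ush : shifted_order_ideal U) (d_lt_n : d < n).
Implicit Types (s t v : seq nat) (A : {set 'I_n}).
Local Notation m := (n - d - 1).

(** The vertices of a set, numbered from 1 as in index sequences. *)
Definition positions A : seq nat := [seq (nat_of_ord i).+1 | i <- enum A].

Lemma mem_positions A (i : 'I_n) : (i.+1 \in positions A) = (i \in A).
Proof.
rewrite -[RHS]mem_enum; apply: mem_map => i1 i2 [eq_i]; exact: val_inj.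
Qed.

Lemma positionsP A x :
  x \in positions A -> exists2 i : 'I_n, i \in A & x = i.+1.
Proof. by case/mapP=> i; rewrite mem_enum => iA ->; exists i. Qed.

Lemma sorted_positions A : sorted ltn (positions A).
Proof.
rewrite sorted_map; apply: (@sub_sorted _ (relpre val ltn)); first by [].
rewrite -sorted_map.
apply: (subseq_sorted ltn_trans (s2 := map val (enum 'I_n))).
  by rewrite map_subseq // {1}/enum_mem -enumT filter_subseq.
by rewrite val_enum_ord iota_ltn_sorted.
Qed.

(** If s_1, s_2 + 2, s_3 + 4, ... all lie in the facet of [u], then the p-th of
    them lies in the p-th pair of the facet or in a later one, because two
    vertices at distance at least two never share a pair, and the final interval
    of the facet is out of reach; so the indices of [u] are at most those of [s],
    and [u] is outside U with [s]. *)
Lemma outside_not_ball s A : outside U s ->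
  {subset alpha2_indices s <= positions A} -> ~ squeezed_ball n d U A.
Proof.
move=> s_out sub_sA [u [Uu /subsetP sub_AF]].
have [/andP[/(sortedP 0) sorted_s /all_nthP s_m] _] := s_out.
set v := indices u in sub_AF; have v_m : index_seq m v := index_seq_indices u.
have /andP[/(sorted_leq_nth leq_trans leqnn 0) v_mono _] := v_m.
have inF p : p < size s ->
    (exists2 q, q < size v &
       nth 0 v q + 2 * q <= nth 0 s p + 2 * p <= nth 0 v q + 2 * q + 1)
    \/ n + 2 * size v - d <= nth 0 s p + 2 * p.
  move=> lt_p; have : nth 0 s p + 2 * p \in positions A.
    by apply: sub_sA; rewrite -nth_alpha2 // mem_nth ?size_alpha2.
  case/positionsP=> i /sub_AF; rewrite inE => + ->.
  case/orP=> [/existsP[q]|]; last by right.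
  by move=> iq; left; exists q => //; case/orP: iq => /eqP ->; lia.
have dom p : p < size s -> p < size v /\ nth 0 v p <= nth 0 s p.
  elim: p => [|p IHp] lt_p.
    have /andP[s0 sm] := s_m 0 _ lt_p.
    case: (inF _ lt_p) => [[q lt_q]|]; last by lia.
    have : nth 0 v 0 <= nth 0 v q by apply: v_mono => //; rewrite inE; lia.
    by lia.
  have /andP[s0 sm] := s_m 0 _ lt_p; have [lt_pv le_p] := IHp (ltnW lt_p).
  have := sorted_s p lt_p; case: (inF _ lt_p) => [[q lt_q]|]; last by lia.
  case: (leqP q p) => [le_qp|lt_pq].
    have : nth 0 v q <= nth 0 v p by apply: v_mono.
    by lia.
  have : nth 0 v p.+1 <= nth 0 v q by apply: v_mono => //; rewrite inE; lia.
  by lia.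
have [_] : outside U v.
  apply: (outside_le Ush s_out v_m) => [|p /dom[] //].
  have := outside_neq0 Ush s_out; case E: (size s) dom => // [k] dom _.
  by case: (dom k); rewrite ?ltnSn.
by rewrite mon_ofK.
Qed.

(** Reads off greedily from an increasing list of vertices the sequence
    s_1 <= s_2 <= ... such that s_1, s_2 + 2, s_3 + 4, ... belong to the list,
    skipping the successor of each chosen vertex and stopping at the first
    value above [m]; [k] vertices are already chosen and [b] bounds the next one
    from below. *)
Fixpoint greedy (k b : nat) (L : seq nat) : seq nat :=
  if L is x :: L' then
    if x < b then greedy k b L'
    else if x - 2 * k <= m then (x - 2 * k) :: greedy k.+1 x.+2 L' else [::]
  else [::].

Lemma greedyP k b (L : seq nat) (s := greedy k b L) :
  2 * k < b -> sorted ltn L ->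
  [/\ path leq (b - 2 * k) s, all (fun j => j <= m) s,
      forall p, p < size s -> nth 0 s p + 2 * (k + p) \in L &
      forall x, x \in L -> [\/ x < b,
        exists2 p, p < size s &
          x = nth 0 s p + 2 * (k + p) \/ x = nth 0 s p + 2 * (k + p) + 1 |
        m + 2 * (k + size s) < x]].
Proof.
rewrite {}/s; elim: L k b => [|x L IHL] k b lt_kb /=; first by split.
rewrite path_sortedE; last exact: ltn_trans.
case/andP=> /allP lt_xL sorted_L; case: ltnP => [lt_xb|le_bx].
  have [p1 p2 p3 p4] := IHL k b lt_kb sorted_L; split=> // [p lt_p|y].
    by rewrite inE p3 ?orbT.
  by rewrite inE => /orP[/eqP->|/p4]; first by constructor 1.
case: leqP => [le_xm|lt_mx] /=; last first.
  split=> // y; rewrite inE => /orP[/eqP->|/lt_xL /= lt_xy]; constructor 3; lia.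
have [||p1 p2 p3 p4] := IHL k.+1 x.+2 => //; first by lia.
split.
- apply/andP; split; first by lia.
  by have -> : x - 2 * k = x.+2 - 2 * k.+1 by lia.
- by rewrite le_xm.
- case=> [_|p lt_p] /=; first by rewrite inE; apply/orP; left; apply/eqP; lia.
  by rewrite inE addnS -addSn p3 ?orbT.
move=> y; rewrite inE => /orP[/eqP->|yL].
  by constructor 2; exists 0 => //; left => /=; lia.
case: (p4 y yL) => [lt_yx|[p lt_p y_p]|lt_my].
- by constructor 2; exists 0 => //; have /= := lt_xL y yL; lia.
- by constructor 2; exists p.+1 => //=; rewrite addnS -addSn.
- by constructor 3; rewrite addnS -addSn.
Qed.

(** Every vertex is chosen, or follows a chosen one, or comes after the point
    where the greedy choice stops; if the chosen sequence belonged to U, this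
    would place the set inside the facet of this sequence. *)
Lemma not_ball_outside A : ~ squeezed_ball n d U A ->
  exists2 s, outside U s & {subset alpha2_indices s <= positions A}.
Proof.
move=> nBA; pose s := greedy 0 1 (positions A).
have [path_s s_m s_A A_s] := greedyP (k := 0) (b := 1) isT (sorted_positions A).
rewrite -/s in path_s s_m s_A A_s.
have s_ind : index_seq m s.
  rewrite /index_seq (path_sorted path_s) /=; apply/allP=> j js.
  rewrite (allP s_m) // andbT.
  by move: path_s; rewrite (path_sortedE leq_trans) => /andP[/allP/(_ j js)].
exists s.
  split=> // Us; apply: nBA; exists (mon_of m s); split=> //.
  rewrite indices_mon_of //; apply/subsetP=> i.
  rewrite -mem_positions => /A_s iP; rewrite inE; apply/orP.
  case: iP => // [[p lt_p iE]|lt_mi]; last by right; lia.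
  left; apply/existsP; exists (Ordinal lt_p); apply/orP => /=.
  by case: iE => ->; [left|right]; rewrite add0n.
move=> x /(nthP 0)[p]; rewrite size_alpha2 => lt_p <-; rewrite nth_alpha2 //.
by rewrite -[2 * p]/(2 * (0 + p)) s_A.
Qed.

End SqueezedBall.


(** * Comparing the numbers of monomials *)

Section FoldExponents.
Implicit Types (e : seq nat) (k p c : nat).

(** A degree preserving injection on exponent lists, which will map the
    monomials of alpha^2(I(U)) into I(U).  The list is scanned for a greedy
    sequence of positions at distance at least two: when the first variable
    occurs, it is output once, and what is left of it is moved to the end of the
    list together with its successor; otherwise the first position is passed.
    The fuel [k] has to reach the length plus the degree of the list. *)
Fixpoint fold_exp k e : seq nat :=
  if k isn't k'.+1 then e else
  match e with
  | 0 :: e' => 0 :: fold_exp k' e'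
  | a.+1 :: b :: e' => incr_nth (fold_exp k' (rcons (rcons e' b) a)) 0
  | _ => e
  end.

Lemma size_fold_exp k e : size (fold_exp k e) = size e.
Proof.
elim: k e => //= k IHk [|[|a] [|b e']] //=; rewrite ?size_incr_nth IHk //.
by rewrite !size_rcons.
Qed.

Lemma sumn_incr_nth0 e : sumn (incr_nth e 0) = (sumn e).+1.
Proof. by case: e. Qed.

Lemma sumn_fold_exp k e : sumn (fold_exp k e) = sumn e.
Proof.
elim: k e => //= k IHk [|[|a] [|b e']] //=; rewrite ?IHk // sumn_incr_nth0 IHk.
by rewrite !sumn_rcons; lia.
Qed.

Lemma fold_exp_inj k e1 e2 :
  size e1 = size e2 -> fold_exp k e1 = fold_exp k e2 -> e1 = e2.
Proof.
elim: k e1 e2 => //= k IHk [|a1 e1] [|a2 e2] //= [eq_sz].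
have head_incr e x r : incr_nth e 0 = x :: r -> 0 < x.
  by case: e => [|y e] /= [<-].
case: a1 a2 e1 e2 eq_sz => [|a1] [|a2] [|b1 e1] [|b2 e2] //= [eq_sz].
- by case=> /IHk->; rewrite //= eq_sz.
- by move/esym/head_incr.
- by move/head_incr.
move=> eq_i; have :
    fold_exp k (rcons (rcons e1 b1) a1) = fold_exp k (rcons (rcons e2 b2) a2).
  have sz : size (fold_exp k (rcons (rcons e1 b1) a1)) =
      size (fold_exp k (rcons (rcons e2 b2) a2)).
    by rewrite !size_fold_exp !size_rcons eq_sz.
  move: eq_i sz.
  case: (fold_exp k _) => [|x1 r1]; case: (fold_exp k _) => [|x2 r2] //.
  by case=> -> ->.
move/IHk; rewrite !size_rcons eq_sz => /(_ erefl)/rcons_inj[+ ->].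
by move/rcons_inj=> -[-> ->].
Qed.

(** If the first exponent is zero, both lists lose their first place.  Otherwise
    one unit is output in the first place, and the rest of the gap sequence [j]
    sits two places earlier in the rotated list, which matches the loss of one
    of its p terms. *)
Lemma fold_exp_gap k e p c (j : nat -> nat) : size e + sumn e <= k ->
  (forall q, q < p -> 0 < nth 0 e (j q)) ->
  (forall q, q.+1 < p -> j q + 2 <= j q.+1) ->
  (0 < p -> j p.-1 < c + 2 * p.-1) ->
  p <= sumn (take c (fold_exp k e)).
Proof.
have j_ge p' (j' : nat -> nat) b q : b <= j' 0 ->
    (forall q, q.+1 < p' -> j' q + 2 <= j' q.+1) ->
    q < p' -> b + 2 * q <= j' q.
  move=> le_b gap; elim: q => [|q IHq] lt_q; first by lia.
  by have := gap q lt_q; have := IHq (ltnW lt_q); lia.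
elim: k e p c j => [|k IHk] [|a e] p c j //=.
- by case: p => // p _ /(_ 0 isT); rewrite nth_nil.
- by case: p => // p _ /(_ 0 isT); rewrite nth_nil.
case: p => // p; case: a => [|a].
  rewrite add0n addSn => lt_k pos gap /(_ isT) /= last_j.
  have j_gt0 q : q < p.+1 -> 0 < j q by move/pos; case: (j q).
  have := j_ge p.+1 j 1 p (j_gt0 0 isT) gap (ltnSn p) => lb.
  case: c last_j => [|c] last_j; first by lia.
  rewrite /= add0n; apply: (IHk _ _ _ (fun q => (j q).-1)) => //.
  - by move=> q lt_q; have := pos q lt_q; have := j_gt0 q lt_q; case: (j q).
  - by move=> q lt_q; have := gap q lt_q; have := j_gt0 q (ltnW lt_q); lia.
  - by move=> _; have := j_gt0 p (ltnSn p); rewrite /=; lia.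
move=> lt_k pos gap /(_ isT) /= last_j.
have := j_ge p.+1 j 0 p (leq0n _) gap (ltnSn p) => lb.
case: c last_j => [|c] last_j; first by lia.
case: e lt_k pos => [|b e] lt_k pos.
  case: p pos gap last_j lb => //= p pos gap _ _.
  have := pos p.+1 (ltnSn _); have := gap p (ltnSn _).
  by case: (j p.+1) => [|[|x]]; rewrite /= ?nth_nil; lia.
have -> : take c.+1 (incr_nth (fold_exp k (rcons (rcons e b) a)) 0) =
    incr_nth (take c.+1 (fold_exp k (rcons (rcons e b) a))) 0.
  by case: (fold_exp _ _).
rewrite sumn_incr_nth0 ltnS; apply: (IHk _ _ _ (fun q => j q.+1 - 2)).
- by rewrite !size_rcons !sumn_rcons; move: lt_k => /=; lia.
- move=> q lt_q; have := pos q.+1 lt_q.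
  have := gap 0 (leq_ltn_trans (leq0n q) lt_q).
  have := j_ge p.+1 j 0 q.+1 (leq0n _) gap lt_q => lb_q _.
  case: (j q.+1) lb_q => [|[|x]] lb_q; rewrite /= ?subn0; try lia.
  move=> pos_x; rewrite subnS subn1 /= !nth_rcons size_rcons.
  case: (ltnP x (size e)) => lt_x; last by rewrite nth_default in pos_x.
  by rewrite (ltn_trans lt_x).
- move=> q lt_q; have := gap q.+1 lt_q.
  have := j_ge p.+1 j 0 q.+1 (leq0n _) gap (ltnW lt_q).
  by lia.
- by case: p {lt_k pos gap lb IHk} last_j => // p; rewrite /=; lia.
Qed.

End FoldExponents.

Lemma sumn_take e n c : size e = n ->
  sumn (take c e) = \sum_(i < n | i < c) nth 0 e i.
Proof.
move=> <-{n}; elim: e c => [|a e IHe] c; first by rewrite /= big_ord0.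
case: c => [|c]; first by rewrite big_pred0.
by rewrite /= IHe [RHS]big_mkcond big_ord_recl /= -big_mkcond.
Qed.

Section FoldMonomials.
Context (n : nat).
Implicit Types (w : 'X_{1..n}).

Definition exps w : seq nat := [seq w i | i <- enum 'I_n].
Definition fold_mon k w : 'X_{1..n} :=
  [multinom nth 0 (fold_exp k (exps w)) i | i < n].

Lemma size_exps w : size (exps w) = n.
Proof. by rewrite size_map size_enum_ord. Qed.

Lemma nth_exps w (i : 'I_n) : nth 0 (exps w) i = w i.
Proof. by rewrite (nth_map i) ?size_enum_ord // nth_ord_enum. Qed.

Lemma sumn_exps w : sumn (exps w) = mdeg w.
Proof. by rewrite sumnE big_map big_enum mdegE. Qed.

Lemma fold_monE k w (i : 'I_n) : fold_mon k w i = nth 0 (fold_exp k (exps w)) i.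
Proof. by rewrite mnmE. Qed.

Lemma fold_mon_inj k : injective (fold_mon k).
Proof.
move=> w1 w2 eq_w.
have /fold_exp_inj : fold_exp k (exps w1) = fold_exp k (exps w2).
  apply: (eq_from_nth (x0 := 0)) => [|i]; rewrite !size_fold_exp !size_exps //.
  by move=> lt_i; rewrite -!(fold_monE _ _ (Ordinal lt_i)) eq_w.
rewrite !size_exps => /(_ erefl) eq_e.
by apply/mnmP=> i; rewrite -!nth_exps eq_e.
Qed.

Lemma sum_fold_mon k w c :
  \sum_(i < n | i < c) fold_mon k w i = sumn (take c (fold_exp k (exps w))).
Proof.
rewrite (@sumn_take _ n) ?size_fold_exp ?size_exps //.
by apply: eq_bigr => i _; rewrite fold_monE.
Qed.

Lemma mdeg_fold_mon k w : mdeg (fold_mon k w) = mdeg w.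
Proof.
rewrite mdegE -sumn_exps -(sumn_fold_exp k) -[in RHS](take_size (fold_exp k _)).
rewrite size_fold_exp size_exps -sum_fold_mon.
by apply: eq_bigl => i; rewrite ltn_ord.
Qed.

Context (m : nat) (U : 'X_{1..m} -> Prop) (Ush : shifted_order_ideal U).

Lemma fold_mon_outside k w : n + mdeg w <= k ->
  alpha2_mon U w -> outside_mon U (fold_mon k w).
Proof.
move=> le_k [s [s_out a_n le_aw]]; apply: (outside_mon_dominate Ush s_out).
move=> p lt_p; rewrite sum_fold_mon.
have [/andP[sorted_s /all_nthP s_m] _] := s_out.
have pos q : q < size s -> 0 < nth 0 s q by move=> /(s_m 0)/andP[].
apply: (fold_exp_gap (p := p.+1) (j := fun q => (nth 0 s q + 2 * q).-1)).
- by rewrite size_exps sumn_exps.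
- move=> q lt_q; have lt_qs : q < size s by lia.
  have := index_seq_alpha2P a_n lt_qs; have := pos q lt_qs.
  move En: (nth 0 s q + 2 * q) => [|j] s_gt0 lt_jn /=; first by lia.
  rewrite (nth_exps w (Ordinal lt_jn)); apply: leq_trans (mnm_lepP le_aw _).
  rewrite mnmE -has_count has_pred1 /= -En -nth_alpha2 //.
  by rewrite mem_nth ?size_alpha2.
- by move=> q lt_q; have := pos q; have/(sortedP 0)/(_ q) := sorted_s; lia.
- by have := pos p lt_p; rewrite /=; lia.
Qed.

End FoldMonomials.


(** * General position *)

Section GeneralPosition.
Import Order.TTheory GRing.Theory.
Local Open Scope ring_scope.
Context (K : fieldType) (n : nat).
Implicit Types (g : 'M[K]_n) (T : {ffun 'I_n -> 'I_n}) (r : nat).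

Definition row_at g (j : nat) : 'rV[K]_n :=
  if insub j is Some i then row i g else 0.

Lemma row_at_ord g (i : 'I_n) : row_at g i = row i g.
Proof. by rewrite /row_at valK. Qed.

Definition inj_below r T : bool :=
  [forall i : 'I_n, forall j : 'I_n,
     [&& (i < r)%N, (j < r)%N & T i == T j] ==> (i == j)].

(** Its determinant is the minor of [g] on the rows T(0), ..., T(r-1) and the
    first [r] columns. *)
Definition completed_mx (R : pzRingType) (g : 'M[R]_n) r T : 'M[R]_n :=
  \matrix_(i, j) if (i < r)%N then g (T i) j else (i == j)%:R.

Definition generic_mx : 'M[{mpoly K[n * n]}]_n :=
  \matrix_(i, j) 'X_(mxvec_index i j).

Definition minors_poly : {mpoly K[n * n]} :=
  \prod_(r < n.+1) \prod_(T | inj_below r T) \det (completed_mx generic_mx r T).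

Lemma minors_polyE g : minors_poly.@[fun k => mxvec g ord0 k] =
  \prod_(r < n.+1) \prod_(T | inj_below r T) \det (completed_mx g r T).
Proof.
rewrite rmorph_prod; apply: eq_bigr => r _.
rewrite rmorph_prod; apply: eq_bigr => T _.
rewrite -det_map_mx; congr (\det _); apply/matrixP=> i j; rewrite !mxE.
case: ifP => _; last by rewrite rmorph_nat.
by rewrite /= mevalXU mxvecE.
Qed.

Lemma minors_poly_neq0 g : minors_poly.@[fun k => mxvec g ord0 k] != 0 ->
  forall r T, (r <= n)%N -> inj_below r T -> \det (completed_mx g r T) != 0.
Proof.
rewrite minors_polyE => /prodf_neq0 g_ok r T le_rn injT.
have /prodf_neq0 := g_ok (Ordinal (le_rn : (r < n.+1)%N)) isT; exact.
Qed.

Lemma free_rows g : g \in unitmx -> free [seq row i g | i <- enum 'I_n].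
Proof.
move=> Ug; have -> : [seq row i g | i <- enum 'I_n] = [tuple row i g | i < n].
  by [].
apply/freeP=> k sum0; have : (\row_i k i) *m g = 0.
  rewrite mulmx_sum_row -[RHS]sum0; apply: eq_bigr => i _.
  by rewrite mxE -tnth_nth tnth_mktuple.
move/(congr1 (mulmxr (invmx g))); rewrite /= mulmxK // mul0mx => k0 i.
by have /rowP/(_ i) := k0; rewrite !mxE.
Qed.

(** By the nonvanishing minors, any [c] of the forms g(x_i) are independent of
    the last n - c variables. *)
Lemma general_position_free g (t : seq nat) c :
  minors_poly.@[fun k => mxvec g ord0 k] != 0 -> (c <= n)%N ->
  uniq t -> size t = c -> all (fun j => (j < n)%N) t ->
  free ([seq row_at g j | j <- t] ++ tail_rows K n c).
Proof.
move=> g_ok le_cn uniq_t sz_t /allP t_n.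
pose T : {ffun 'I_n -> 'I_n} := [ffun i : 'I_n => insubd i (nth 0%N t i)].
have TE (i : 'I_n) : (i < c)%N -> val (T i) = nth 0%N t i.
  by move=> lt_i; rewrite ffunE val_insubd t_n ?mem_nth ?sz_t.
have injT : inj_below c T.
  apply/forallP=> i; apply/forallP=> j; apply/implyP=> /and3P[lt_i lt_j].
  by rewrite -val_eqE !TE // nth_uniq ?sz_t.
have := minors_poly_neq0 g_ok le_cn injT; rewrite -unitfE => /free_rows.
congr (is_true (free _)); apply: (eq_from_nth (x0 := 0)).
  rewrite size_map size_enum_ord size_cat !size_map size_iota sz_t; lia.
move=> i; rewrite size_map size_enum_ord => lt_i.
rewrite (nth_map (Ordinal lt_i)) ?size_enum_ord // nth_cat size_map sz_t.
rewrite (nth_ord_enum _ (Ordinal lt_i)); case: ifP => lt_ic.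
  rewrite (nth_map 0%N) ?sz_t // -(TE (Ordinal lt_i)) // row_at_ord.
  by apply/rowP=> j; rewrite !mxE lt_ic.
rewrite (nth_map 0%N) ?size_iota ?nth_iota; try lia.
by apply/rowP=> j; rewrite !mxE lt_ic -val_eqE /= eq_sym subnKC // leqNgt lt_ic.
Qed.

Lemma infinite_field_inj (k : nat) : infinite_field K ->
  exists t : seq K, uniq t && (size t == k).
Proof.
move=> K_inf; elim: k => [|k [t /andP[uniq_t /eqP sz_t]]]; first by exists [::].
by have [x x_t] := K_inf t; exists (x :: t); rewrite /= x_t uniq_t sz_t eqxx.
Qed.

(** A Vandermonde matrix is in general position: a combination of its first [r]
    columns that vanishes on [r] rows is a polynomial of degree less than [r]
    with [r] roots. *)
Lemma general_position_exists : infinite_field K ->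
  exists g, g \in unitmx /\ minors_poly.@[fun k => mxvec g ord0 k] != 0.
Proof.
case/(infinite_field_inj n)=> t /andP[uniq_t /eqP sz_t].
pose g : 'M[K]_n := \matrix_(i, j) t`_i ^+ j.
have det_neq0 r T : (r <= n)%N -> inj_below r T ->
    \det (completed_mx g r T) != 0.
  move=> le_rn injT; rewrite -det_tr; apply/negP=> /det0P[v v_neq0 vM].
  have eqn (i : 'I_n) : \sum_j v ord0 j * completed_mx g r T i j = 0.
    have /rowP/(_ i) := vM; rewrite [LHS]mxE [RHS]mxE => vM_i.
    rewrite -[RHS]vM_i; apply: eq_bigr => j _.
    by rewrite [in RHS]mxE.
  have v_tail (i : 'I_n) : (r <= i)%N -> v ord0 i = 0.
    move=> le_ri; rewrite -[RHS](eqn i) (bigD1 i) //=.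
    rewrite mxE ltnNge le_ri eqxx mulr1.
    rewrite big1 ?addr0 // => j ne_ji.
    by rewrite mxE ltnNge le_ri eq_sym (negPf ne_ji) mulr0.
  pose vc j : K := if insub j is Some i then v ord0 i else 0.
  pose p : {poly K} := \poly_(j < r) vc j.
  have p_eval x : p.[x] = \sum_(j < n) v ord0 j * x ^+ j.
    rewrite horner_poly (big_ord_widen _ (fun j => vc j * x ^+ j) le_rn).
    rewrite big_mkcond; apply: eq_bigr => j _; rewrite /vc valK.
    by case: ltnP => // /v_tail->; rewrite mul0r.
  have p0 : p = 0.
    apply/eqP; apply: contraT => /max_poly_roots.
    move/(_ [seq t`_(T i) | i : 'I_n <- enum 'I_n & (i < r)%N]).
    have sz : size [seq t`_(T i) | i : 'I_n <- enum 'I_n & (i < r)%N] = r.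
      rewrite size_map size_filter -(count_map val (fun i => (i < r)%N)).
      rewrite val_enum_ord.
      rewrite -size_filter -[in RHS](size_iota 0 r); congr size.
      rewrite -[in LHS](subnKC le_rn) iotaD filter_cat add0n.
      rewrite (all_filterP _); last by apply/allP=> i; rewrite mem_iota.
      rewrite (eq_in_filter (a2 := pred0)) ?filter_pred0 ?cats0 // => i.
      by rewrite mem_iota => /andP[le_ri _] /=; rewrite ltnNge le_ri.
    rewrite sz ltnNge size_poly; apply.
      apply/allP=> _ /mapP[i + ->]; rewrite mem_filter => /andP[lt_ir _].
      rewrite rootE p_eval -[X in _ == X](eqn i); apply/eqP/eq_bigr => j _.
      by rewrite !mxE lt_ir.
    rewrite map_inj_in_uniq ?filter_uniq -?enumT ?enum_uniq // => i j.
    rewrite !mem_filter => /andP[lt_i _] /andP[lt_j _] /eqP.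
    rewrite nth_uniq ?sz_t // => eqT.
    have /forallP/(_ i)/forallP/(_ j) := injT.
    by rewrite lt_i lt_j val_eqE in eqT *; rewrite eqT => /eqP.
  case/eqP: v_neq0; apply/rowP=> i; rewrite mxE.
  case: (ltnP i r) => [lt_i|]; last exact: v_tail.
  have : p`_i = 0 by rewrite p0 coef0.
  by rewrite coef_poly lt_i /vc valK.
exists g; split; last first.
  rewrite minors_polyE; apply/prodf_neq0 => r _; apply/prodf_neq0 => T.
  by apply: det_neq0; rewrite -ltnS.
rewrite unitmxE unitfE; have <- : completed_mx g n [ffun i => i] = g.
  by apply/matrixP=> i j; rewrite mxE ltn_ord ffunE.
apply: det_neq0 => //; apply/forallP=> i; apply/forallP=> j.
by rewrite !ffunE; apply/implyP=> /and3P[].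
Qed.

End GeneralPosition.


(** * Monomial ideals *)

Lemma finite_decidable (T : finType) (P : T -> Prop) :
  exists b : T -> bool, forall x, b x <-> P x.
Proof.
suff /fin_all_exists : forall x, exists b : bool, b <-> P x by [].
by move=> x; have [Px|nPx] := classic (P x); [exists true | exists false].
Qed.

Section MonomialIdeals.
Import Order.TTheory GRing.Theory.
Local Open Scope ring_scope.
Context (K : fieldType) (n : nat).
Implicit Types (S : {mpoly K[n]} -> Prop) (f h : {mpoly K[n]}).
Implicit Types (u v w : 'X_{1..n}).

Lemma ideal_genD S f h : ideal_gen S f -> ideal_gen S h -> ideal_gen S (f + h).
Proof.
move=> [s [Ss ->]] [t [St ->]]; exists (s ++ t); split; last by rewrite big_cat.
by move=> p; rewrite mem_cat => /orP[/Ss|/St].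
Qed.

Lemma ideal_gen0 S : ideal_gen S 0.
Proof. by exists [::]; split; rewrite ?big_nil. Qed.

Lemma ideal_gen_mull S a p : S p -> ideal_gen S (a * p).
Proof.
move=> Sp; exists [:: (a, p)]; split; rewrite ?big_seq1 // => q.
by rewrite inE => /eqP->.
Qed.

Lemma ideal_gen_monP S (G : 'X_{1..n} -> Prop) f :
  (forall p, S p <-> exists u, G u /\ p = 'X_[u]) ->
  ideal_gen S f <->
  forall w, w \in msupp f -> exists2 u, G u & (u <= w)%MM.
Proof.
move=> SE; split=> [[s [Ss ->]] w|fG].
  rewrite big_seq => /msupp_sum_le/flattenP[_ /mapP[p + ->]].
  rewrite mem_filter andbb => ps; have /SE[u [Gu ->]] := Ss p ps.
  rewrite (perm_mem (msuppMX _ _)) => /mapP[v _ ->]; exists u => //.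
  exact: lem_addr.
rewrite (mpolyE f) big_seq; apply: big_ind => [||w wf].
- exact: ideal_gen0.
- by move=> *; apply: ideal_genD.
have [u Gu le_uw] := fG w wf; rewrite -(submK le_uw) mpolyXD scalerAl.
by apply: ideal_gen_mull; apply/SE; exists u.
Qed.

End MonomialIdeals.

(** * Images of monomials in gap ideals *)

Section GapProducts.
Import Order.TTheory GRing.Theory.
Local Open Scope ring_scope.
Context (K : fieldType) (n : nat).

Lemma lin_subst_mon_of (g : 'M[K]_n) (a : seq nat) :
  all (fun j => 0 < j <= n)%N a ->
  lin_subst g 'X_[mon_of n a] = \prod_(j <- a) linear_form (row_at g j.-1).
Proof.
elim: a => [_|j a IHa /= /andP[/andP[j_gt0 le_jn] /IHa aE]].
  have -> : mon_of n [::] = 0%MM by apply/mnmP=> i; rewrite !mnmE.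
  by rewrite big_nil mpolyX0 lin_subst1.
case: j j_gt0 le_jn => // j _ lt_jn; rewrite big_cons -aE.
have -> : mon_of n (j.+1 :: a) = (U_(Ordinal lt_jn) + mon_of n a)%MM.
  by apply/mnmP=> i; rewrite mnmDE mnm1E !mnmE.
by rewrite mpolyXD lin_substM lin_substXU -row_at_ord.
Qed.

(** The gaps leave at least 2(p - 1) indices between the first and the p-th
    factor, so that for c = 0 there is no product to consider. *)
Lemma gap_ideal_prod (l : nat -> 'rV[K]_n) Z p c s (b : seq nat) :
  sorted gap2 b -> all (leq s) b -> (p <= size b)%N ->
  (0 < p -> nth 0%N b p.-1 < s + c + 2 * p.-1)%N ->
  gap_ideal l Z p c s (\prod_(j <- b) linear_form (l j)).
Proof.
have gap2_trans : transitive gap2 by move=> x y z; rewrite /gap2; lia.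
elim: p c s b => // p IHp; elim=> [|c IHc] s b gap_b ge_b le_p lt_b.
  have := lt_b isT; suff : (s + 2 * p <= nth 0 b p)%N by rewrite /=; lia.
  elim: p le_p {IHp lt_b} => [|p IHp] le_p.
    by move/(all_nthP 0%N): ge_b => /(_ 0%N le_p); lia.
  have := IHp (ltnW le_p); have /(sortedP 0%N)/(_ p le_p) := gap_b.
  by rewrite /gap2; lia.
case: b gap_b ge_b le_p lt_b => // x b gap_b /= /andP[le_sx ge_b] le_p lt_b.
have /allP gap_x : all (gap2 x) b.
  by move: gap_b; rewrite /= (path_sortedE gap2_trans) => /andP[].
apply/gap_idealE; have [eq_sx|ne_sx] := eqVneq s x.
  exists (\prod_(j <- b) linear_form (l j)), 0.
  split; last by rewrite big_cons eq_sx addr0.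
    apply: (IHp) => //; first exact: path_sorted gap_b.
      by apply/allP=> j /gap_x; rewrite /gap2 eq_sx; lia.
    by case: (p) lt_b => // p' /(_ isT) /=; lia.
  exact: gap_ideal0.
exists 0, (\prod_(j <- x :: b) linear_form (l j)).
split; [exact: gap_ideal0| |by rewrite mulr0 add0r].
apply: IHc => //.
  have lt_sx : (s < x)%N by rewrite ltn_neqAle ne_sx.
  by rewrite /= lt_sx; apply/allP=> j /gap_x; rewrite /gap2; lia.
by move=> _; have := lt_b isT; rewrite /= addnS addSn.
Qed.

Lemma alpha2_image_gap (g : 'M[K]_n) Z p c (v : 'X_{1..n}) :
  index_seq n (alpha2_indices (indices v)) -> (p < mdeg v)%N ->
  (nth 0%N (indices v) p <= c)%N ->
  gap_ideal (row_at g) Z p.+1 c 0 (lin_subst g 'X_[alpha2_image v]).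
Proof.
move=> v_n; rewrite -size_indices => lt_p le_c.
set a := alpha2_indices (indices v) in v_n *.
have sz_a : size a = size (indices v) by rewrite size_alpha2.
have /andP[sorted_v /(all_nthP 0%N)/(_ p lt_p)/andP[v_gt0 _]] :=
  index_seq_indices v.
have a_gt0 q : (q < size a)%N -> (0 < nth 0%N a q)%N.
  by case/andP: v_n => _ /all_nthP a_n /(a_n 0%N)/andP[].
rewrite lin_subst_mon_of; last by case/andP: v_n.
rewrite -(big_map predn xpredT (fun j => linear_form (row_at g j))).
have sz_b : size [seq j.-1 | j <- a] = size a by rewrite size_map.
apply: gap_ideal_prod; rewrite ?sz_b ?sz_a //.
- apply/(sortedP 0%N) => q; rewrite sz_b => lt_q.
  rewrite !(nth_map 0%N 0%N predn) ?(ltnW lt_q) //.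
  have /(sortedP 0%N)/(_ q lt_q) := alpha2_gap sorted_v; rewrite -/a.
  by have := a_gt0 q (ltnW lt_q); rewrite /gap2; lia.
- by apply/allP.
- move=> _ /=; rewrite (nth_map 0%N 0%N predn) ?sz_a // nth_alpha2 //; lia.
Qed.

End GapProducts.

(** * The ideals of a squeezed ball *)

Section Squeezed.
Import Order.TTheory GRing.Theory.
Local Open Scope ring_scope.
Context (K : fieldType) (n d : nat) (d_lt_n : (d < n)%N).
Context (U : 'X_{1..n - d - 1} -> Prop) (Ush : shifted_order_ideal U).
Implicit Types (f h : {mpoly K[n]}) (u v w : 'X_{1..n}) (A : {set 'I_n}).
Local Notation m := (n - d - 1)%N.
Local Notation SR := (stanley_reisner_ideal K (squeezed_ball n d U)).

Let le_mn : (m <= n)%N. Proof. lia. Qed.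

Lemma ideal_outsideP f : ideal_outside K n U f <->
  forall w, w \in msupp f -> outside_mon U w.
Proof.
pose G u := exists2 s, outside U s & u = mon_of n s.
apply: iff_trans (ideal_gen_monP (G := G) _ _) _; last first.
  split=> fG w /fG[]; first by move=> _ [s s_out ->]; exists s.
  by move=> s s_out le_sw; exists (mon_of n s) => //; exists s.
move=> p; split=> [[u [nUu ->]]|[_ [[s [s_m nUs] ->] ->]]].
  exists (mon_of n (indices u)); split; last by rewrite mon_embed_indices.
  by exists (indices u) => //; apply: outside_indices.
by exists (mon_of m s); split; rewrite // mon_embed_mon_of.
Qed.

Lemma ideal_outside_mon u : ideal_outside K n U 'X_[u] <-> outside_mon U u.
Proof.
split=> [/ideal_outsideP|u_out]; first by apply; rewrite msuppX inE.
by apply/ideal_outsideP=> w; rewrite msuppX inE => /eqP->.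
Qed.

Definition set_mon A : 'X_{1..n} := [multinom (i \in A : nat) | i < n].

Lemma prod_set_mon A : \prod_(i in A) 'X_i = 'X_[set_mon A] :> {mpoly K[n]}.
Proof.
rewrite mprodXE; congr 'X_[_]; apply/mnmP=> j; rewrite mnm_sumE mnmE.
under eq_bigr do rewrite mnm1E.
rewrite (big_mkcond (fun i => i \in A)) (bigD1 j) //= big1 ?addn0 => [|i ne_ij].
  by rewrite eqxx.
by rewrite (negPf ne_ij) if_same.
Qed.

Lemma stanley_reisnerP f : SR f <-> forall w, w \in msupp f -> alpha2_mon U w.
Proof.
pose G u := exists2 A, ~ squeezed_ball n d U A & u = set_mon A.
apply: iff_trans (ideal_gen_monP (G := G) _ _) _; last first.
  split=> fG w /fG[].
    move=> _ [A nBA ->] le_Aw.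
    have [s s_out s_A] := not_ball_outside d_lt_n nBA; exists s.
    have [/andP[sorted_s _] _] := s_out; have gap_s := alpha2_gap sorted_s.
    have s_n : index_seq n (alpha2_indices s).
      rewrite /index_seq (sub_sorted _ gap_s) /=; last first.
        by move=> x y; rewrite /gap2; lia.
      by apply/allP=> x /s_A/positionsP[i _ ->]; rewrite /= ltn_ord.
    split=> //; apply: lepm_trans le_Aw; apply/mnm_lepP=> i; rewrite !mnmE.
    have uniq_s : uniq (alpha2_indices s).
      apply: (sorted_uniq ltn_trans ltnn); apply: sub_sorted gap_s.
      by move=> x y; rewrite /gap2; lia.
    rewrite count_uniq_mem //; case: (boolP (i.+1 \in _)) => // /s_A.
    by rewrite mem_positions => ->.
  move=> s [s_out s_n le_sw].
  pose A := [set i : 'I_n | i.+1 \in alpha2_indices s].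
  exists (set_mon A); first exists A => //.
    apply: (outside_not_ball Ush d_lt_n s_out) => x xs.
    have /andP[_ /allP/(_ x xs)] := s_n.
    case: x xs => // x xs /= lt_xn; rewrite (mem_positions _ (Ordinal lt_xn)).
    by rewrite inE.
  apply: lepm_trans le_sw; apply/mnm_lepP=> i; rewrite !mnmE inE.
  by case: (boolP (i.+1 \in _)) => //; rewrite -has_pred1 has_count.
move=> p; split=> [[A [nBA ->]]|[_ [[A nBA ->] ->]]].
  by exists (set_mon A); split; [exists A | exact: prod_set_mon].
by exists A; rewrite prod_set_mon.
Qed.

Lemma alpha2_idealP f : alpha2_ideal (ideal_outside K n U) f <->
  forall w, w \in msupp f -> alpha2_mon U w.
Proof.
pose G w := exists2 u, min_gens (ideal_outside K n U) u & is_alpha2 u w.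
apply: iff_trans (ideal_gen_monP (G := G) _ _) _; last first.
  split=> fG w /fG[].
    move=> w0 [u [/ideal_outside_mon[s s_out le_su] min_u] u_w0] le_w0w.
    have eq_su : mon_of n s = u.
      apply: min_u le_su; apply/ideal_outside_mon.
      by exists s; rewrite ?lepm_refl.
    have [s_m _] := s_out.
    have w0E : indices w0 = alpha2_indices s.
      by rewrite u_w0 -eq_su indices_mon_of // (index_seq_widen le_mn).
    exists s; rewrite -w0E mon_ofK; split=> //; exact: index_seq_indices.
  move=> s [s_out s_n le_sw].
  have [k [le_k k_out pre_in]] := outside_min Ush s_out.
  have k_n : index_seq n (alpha2_indices (take k s)).
    by rewrite alpha2_take index_seq_take.
  exists (mon_of n (alpha2_indices (take k s))).
    exists (mon_of n (take k s)).
      split.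
        apply/ideal_outside_mon.
        by exists (take k s); rewrite ?lepm_refl.
      move=> v /ideal_outside_mon; apply: (outside_min_gen Ush le_mn k_out).
      by rewrite size_takel // take_takel ?leq_pred.
    have [k_m _] := k_out.
    by rewrite /is_alpha2 !indices_mon_of // (index_seq_widen le_mn).
  by apply: lepm_trans le_sw; rewrite alpha2_take mon_of_take.
move=> p; split=> [[u [w [min_u u_w ->]]]|[w [[u min_u u_w] ->]]].
  by exists w; split=> //; exists u.
by exists u, w.
Qed.

(** * The generic initial ideal *)

Hypothesis Udeg : degree_at_most U ((d + 1) %/ 2)%N.
Variable g : 'M[K]_n.
Hypotheses (Ug : g \in unitmx)
  (g_minors : (minors_poly K n).@[fun k => mxvec g ord0 k] != 0).

Definition lead_of_image w : Prop :=
  exists f, lin_image g SR f /\ is_lead_mon f w.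

Lemma lead_of_imageM w u : lead_of_image w -> lead_of_image (w + u)%MM.
Proof.
move=> [_ [[h [SRh ->]] lead_w]]; exists (lin_subst g h * 'X_[u]).
split; last exact: lead_monM.
exists (h * lin_subst (invmx g) 'X_[u]); split; last first.
  by rewrite lin_substM lin_substVK.
apply/stanley_reisnerP=> _ /msuppM_le/allpairsP[[v1 v2] [/= v1h _ ->]].
apply: alpha2_mon_le (lem_addr _ _).
by have /stanley_reisnerP := SRh; apply.
Qed.

Definition dominated (s : seq nat) v : bool := (mdeg v == size s) &&
  [forall p : 'I_(size s), (p < \sum_(i < n | (i < nth 0%N s p)%N) v i)%N].

Lemma dominatedP s v : dominated s v -> mdeg v = size s /\
  forall p, (p < size s)%N -> (nth 0%N (indices v) p <= nth 0%N s p)%N.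
Proof.
case/andP=> /eqP deg_v /forallP dom; split=> // p lt_p.
have /andP[sorted_v _] := index_seq_indices v.
rewrite leq_count_sorted ?size_indices ?deg_v // count_indices.
exact: (dom (Ordinal lt_p)).
Qed.

Lemma dominated_mon_of s : index_seq n s -> dominated s (mon_of n s).
Proof.
move=> s_n; rewrite /dominated -size_indices indices_mon_of // eqxx.
have /andP[sorted_s _] := s_n; apply/forallP=> p.
rewrite -(count_indices (mon_of n s) (fun j => (j <= nth 0%N s p)%N)).
by rewrite indices_mon_of // -leq_count_sorted.
Qed.

(** The minimal generators of I(U) have degree at most (d + 1)/2 + 1, and this
    bound keeps their images under alpha^2 within x_1, ..., x_n. *)
Lemma dominated_outside s v : outside U s ->
  (size s <= ((d + 1) %/ 2).+1)%N -> dominated s v ->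
  outside U (indices v) /\ index_seq n (alpha2_indices (indices v)).
Proof.
move=> s_out le_s /dominatedP[deg_v le_v].
have [/andP[_ /all_nthP s_bd] _] := s_out.
have /andP[sorted_v v_n] := index_seq_indices v.
split.
  apply: outside_le s_out _ _ _ => //; last by rewrite size_indices deg_v.
  rewrite /index_seq sorted_v; apply/(all_nthP 0%N) => p lt_p.
  have /(all_nthP 0%N)/(_ p lt_p)/andP[-> _] := v_n.
  rewrite size_indices deg_v in lt_p.
  by apply: leq_trans (le_v p lt_p) _; have /andP[] := s_bd 0%N p lt_p.
apply: index_seq_alpha2; first exact: index_seq_indices.
move=> p; rewrite size_indices deg_v => lt_p.
by have := le_v p lt_p; have := s_bd 0%N p lt_p; lia.
Qed.

(** The forms l_i = g(x_i) are in general position.  The images of the monomials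
    alpha^2(v), for v dominated by [s], span a space contained in the gap ideal
    with parameters p + 1 and s_p for every p, so all its leading monomials are
    dominated by [s]; as the images are linearly independent, these leading
    monomials are all the monomials dominated by [s], including the one of
    [s]. *)
Lemma lead_of_image_outside (s : seq nat) : outside U s ->
  (size s <= ((d + 1) %/ 2).+1)%N -> lead_of_image (mon_of n s).
Proof.
move=> s_out le_s; have [s_m _] := s_out.
have dom_out v := dominated_outside (v := v) s_out le_s.
pose k := size s.
pose D : finType := {v : 'X_{1..n < k.+1} | dominated s (bmnm v)}.
pose wt (v : D) : 'X_{1..n} := bmnm (val v).
have DP (v : D) : dominated s (wt v) by exact: valP v.
have wt_onto w : dominated s w -> exists v : D, wt v = w.
  move=> Dw; have deg_w : (mdeg w < k.+1)%N by have [->] := dominatedP Dw.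
  by exists (Sub (BMultinom deg_w) Dw).
pose F (v : D) : {mpoly K[n]} := lin_subst g 'X_[alpha2_image (wt v)].
have sumF (c : D -> K) :
    \sum_v c v *: F v = lin_subst g (\sum_v c v *: 'X_[alpha2_image (wt v)]).
  by rewrite lin_subst_sum; apply: eq_bigr => v _; rewrite lin_substZ.
have image_inj (v1 v2 : D) :
    (alpha2_image (wt v1) == alpha2_image (wt v2)) = (v1 == v2).
  apply/eqP/eqP=> [eq_mon|->//]; do 2!apply: val_inj => /=.
  have [_ n1] := dom_out _ (DP v1); have [_ n2] := dom_out _ (DP v2).
  rewrite -[LHS](mon_ofK (wt v1)) -[RHS](mon_ofK (wt v2)); congr mon_of.
  apply: alpha2_inj; rewrite -(indices_mon_of n1) -(indices_mon_of n2).
  by congr indices.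
have [vs vsE] := wt_onto _ (dominated_mon_of (index_seq_widen le_mn s_m)).
have [] := @lead_mon_onto K n D F D wt _ _ (leqnn _) vs.
- move=> c; rewrite sumF => /(congr1 (lin_subst (invmx g))).
  rewrite lin_subst0 lin_substK // => sum0 v.
  move/(congr1 (mcoeff (alpha2_image (wt v)))): sum0.
  rewrite mcoeff0 raddf_sum (bigD1 v) //= mcoeffZ mcoeffX eqxx mulr1.
  rewrite big1 ?addr0 // => v' ne_v'.
  by rewrite mcoeffZ mcoeffX image_inj (negPf ne_v') mulr0.
- move=> c w lead_w.
  have homF v : v \in msupp (\sum_v c v *: F v) -> mdeg v = k.
    rewrite sumF => /msupp_lin_subst[v' v'_in <-].
    move/msupp_sum_le/flattenP: v'_in => [_ /mapP[v'' _ ->]] /msuppZ_le.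
    rewrite msuppX inE => /eqP->; have [_ n''] := dom_out _ (DP v'').
    rewrite -size_indices indices_mon_of // size_alpha2 size_indices.
    by have [] := dominatedP (DP v'').
  have [|v <-] := wt_onto w; last by exists v.
  have deg_w : mdeg w = k by apply: homF; case: lead_w.
  rewrite /dominated deg_w eqxx; apply/forallP=> p.
  have /andP[_ /(all_nthP 0%N)/(_ p (ltn_ord p))/andP[s_gt0 le_sm]] := s_m.
  have le_sn := leq_trans le_sm le_mn.
  apply: (@gap_ideal_lead K n (row_at g) _ p.+1 k _ w) lead_w => //.
    move=> T uniq_T sz_T /= lt_T; apply: general_position_free => //.
    have lt_ps : (p < size s)%N := ltn_ord p.
    by apply: sub_all lt_T => j; lia.
  apply: big_ind => [|f1 f2|v _]; [exact: gap_ideal0|exact: gap_idealD|].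
  rewrite -mul_mpolyC; apply: gap_idealM.
  have [_ v_n] := dom_out _ (DP v); have [deg_v le_v] := dominatedP (DP v).
  by apply: alpha2_image_gap; rewrite ?deg_v // le_v.
move=> c; rewrite vsE => lead_s.
exists (\sum_v c v *: F v); split=> //; rewrite sumF.
eexists; split; [|by []]; apply/stanley_reisnerP=> w.
move/msupp_sum_le/flattenP=> [_ /mapP[v _ ->]] /msuppZ_le.
rewrite msuppX inE => /eqP->; have [v_out v_n] := dom_out _ (DP v).
by exists (indices (wt v)); rewrite lepm_refl.
Qed.

(** By the bound on the degrees in U, a long sequence outside U has a prefix
    outside U of the length that the previous lemma admits. *)
Lemma outside_lead_of_image w : outside_mon U w -> lead_of_image w.
Proof.
move=> [s s_out le_sw].
suff [t t_out le_t] : exists2 t, outside U t /\ (mon_of n t <= mon_of n s)%MM &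
    (size t <= ((d + 1) %/ 2).+1)%N.
  have [{}t_out le_ts] := t_out.
  rewrite -(submK (lepm_trans le_ts le_sw)) addmC; apply: lead_of_imageM.
  exact: lead_of_image_outside.
have [le_s|lt_s] := leqP (size s) ((d + 1) %/ 2).+1.
  by exists s => //; split=> //; apply: lepm_refl.
exists (take ((d + 1) %/ 2).+1 s); last by rewrite size_takel // ltnW.
have [s_m _] := s_out; split; last exact: mon_of_take.
split; first exact: index_seq_take.
move/Udeg; rewrite -size_indices indices_mon_of ?index_seq_take //.
by rewrite size_takel ?ltnn // ltnW.
Qed.

(** Up to any degree, the ideal of the ball has at most as many monomials as
    I(U), and all of the latter are leading monomials of the image of the
    former; as distinct leading monomials are independent, there is no room for
    another one. *)
Lemma lead_of_image_inside w : lead_of_image w -> outside_mon U w.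
Proof.
move=> lead_w; have [//|w_in] := classic (outside_mon U w); exfalso.
pose q := mdeg w; pose T := 'X_{1..n < q.+1} : finType.
have [inI inIP] := finite_decidable (fun v : T => outside_mon U (bmnm v)).
have [inJ inJP] := finite_decidable (fun v : T => alpha2_mon U (bmnm v)).
(* To the monomials of I(U) up to the degree of w one more, w, is added. *)
pose wt (i : option {v : T | inI v}) : 'X_{1..n} :=
  oapp (fun x => bmnm (val x)) w i.
have wt_inj : injective wt.
  have nw (v : {v : T | inI v}) : bmnm (val v) <> w.
    by move=> vw; apply: w_in; rewrite -vw; apply/inIP/(valP v).
  move=> [v1|] [v2|] //=; [|by move/nw|by move/esym/nw].
  by move=> eq_v; congr Some; do 2!apply: val_inj.
have wtP i : lead_of_image (wt i) /\ (mdeg (wt i) <= q)%N.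
  case: i => [v|] //=; split; last by rewrite -ltnS bmdeg.
  by apply/outside_lead_of_image/inIP/(valP v).
pose FcT : Type := ({mpoly K[n]} * ({v : T | inJ v} -> K))%type.
have [Fc FcP] : exists Fc : option {v : T | inI v} -> FcT,
    forall i, is_lead_mon (Fc i).1 (wt i) /\
      (Fc i).1 = \sum_j (Fc i).2 j *: lin_subst g 'X_[bmnm (val j)].
  suff /fin_all_exists : forall i, exists Fc : FcT, is_lead_mon Fc.1 (wt i) /\
      Fc.1 = \sum_j Fc.2 j *: lin_subst g 'X_[bmnm (val j)] by [].
  move=> i.
  have [[_ [[h [/stanley_reisnerP SRh ->]] lead_i]] deg_i] := wtP i.
  exists (lin_subst g h, fun j => h@_(bmnm (val j))); split=> //=.
  under eq_bigr do rewrite -lin_substZ.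
  rewrite -lin_subst_sum; congr lin_subst; apply/mpolyP=> v.
  rewrite raddf_sum /=.
  have [v_h|v_h] := boolP (v \in msupp h); last first.
    rewrite memN_msupp_eq0 // big1 // => j _; rewrite mcoeffZ mcoeffX.
    case: eqP => [eq_j|_]; last by rewrite mulr0.
    by rewrite eq_j (memN_msupp_eq0 v_h) mul0r.
  have deg_v : (mdeg v < q.+1)%N.
    have := v_h; rewrite -{1}(lin_substK Ug h) => /msupp_lin_subst[v' v'_in <-].
    rewrite ltnS; apply: leq_trans deg_i; have [->//|ne_v'] := eqVneq v' (wt i).
    by case: lead_i => _ /(_ v' v'_in ne_v')/degrevlex_mdeg.
  have v_J : inJ (BMultinom deg_v) by apply/inJP/SRh.
  rewrite (bigD1 (exist _ (BMultinom deg_v) v_J)) //=.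
  rewrite mcoeffZ mcoeffX eqxx mulr1.
  rewrite big1 ?addr0 // => j ne_j; rewrite mcoeffZ mcoeffX.
  case: (bmnm (val j) =P v) => [eq_j|_]; last by rewrite mulr0.
  by case/eqP: ne_j; do 2!apply: val_inj.
have := lead_mon_card wt_inj (fun i => (FcP i).1) (fun i => (FcP i).2).
rewrite card_option !card_sig leqNgt ltnS => /negP[].
have fold_deg (v : T) : (mdeg (fold_mon (n + q) (bmnm v)) < q.+1)%N.
  by rewrite mdeg_fold_mon bmdeg.
pose fold_T (v : T) : T := BMultinom (fold_deg v).
rewrite -(card_in_imset (f := fold_T)); last first.
  by move=> v1 v2 _ _ /(congr1 val)/= /fold_mon_inj eq_v; apply: val_inj.
apply/subset_leq_card/subsetP=> _ /imsetP[v v_J ->]; apply/inIP.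
apply: (fold_mon_outside Ush); first by rewrite leq_add2l -ltnS bmdeg.
exact/inJP.
Qed.

Lemma initial_ideal_image f :
  initial_ideal (lin_image g SR) f <-> ideal_outside K n U f.
Proof.
apply: iff_trans (iff_sym (ideal_outsideP f)).
apply: iff_trans (ideal_gen_monP (G := lead_of_image) _ _) _; last first.
  split=> fG w /fG; last first.
    by move=> /outside_lead_of_image; exists w; rewrite ?lepm_refl.
  by case=> u /lead_of_image_inside u_out /(outside_mon_le u_out).
move=> p; split=> [[f' [u [imf' lead_u ->]]]|[u [[f' [imf' lead_u]] ->]]].
  by exists u; split=> //; exists f'.
by exists f', u.
Qed.

End Squeezed.

Theorem proposition4p1 (K : fieldType) (K_infinite : infinite_field K)
    (n d : nat) (d_gt0 : (0 < d)%N) (d_lt_n : (d < n)%N)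
    (U : 'X_{1..n - d - 1} -> Prop)
    (U_shifted : shifted_order_ideal U)
    (U_degree : degree_at_most U ((d + 1) %/ 2)%N) :
  (forall f : {mpoly K[n]},
     stanley_reisner_ideal K (squeezed_ball n d U) f <->
     alpha2_ideal (ideal_outside K n U) f) /\
  is_gin (stanley_reisner_ideal K (squeezed_ball n d U))
         (ideal_outside K n U).
Proof.
split=> [f|].
  exact: iff_trans (stanley_reisnerP _ _ _) (iff_sym (alpha2_idealP _ _ _)).
exists (fun g => g \in unitmx /\
  (minors_poly K n).@[fun k => mxvec g ord0 k] != GRing.zero); split.
- exists (fun P => P = minors_poly K n) => g.
  split=> [[Ug g_ok]|[Ug [_ [-> g_ok]]]] //.
  by split=> //; exists (minors_poly K n).
- exact: general_position_exists.
- by move=> g [Ug g_ok] f; apply: initial_ideal_image.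
Qed.
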